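(* Let $(P,\tau,M,h,\omega)$ be a presymplectic cover of a precontact manifold $(M,C)$, with Liouville 1-form $\theta$, and let $X$ be an $\mathbb R^\times$-presymplectic vector field, i.e., $X$ is an $\mathbb R^\times$-invariant vector field on $P$ such that $\mathcal L_X\theta=0$. Then $X$ admits a unique 1-homogeneous Hamiltonian $H$, defined by $H=i_X\theta$. Consequently, any contact vector field $X^c$ on $M$ determines a unique 1-homogeneous Hamiltonian $H$ on $P$ and a unique $\mathbb R^\times$-invariant Hamiltonian vector field $X$ on $P$ such that $i_X\omega=-dH$ and $\tau_*(X)=X^c$.
   Context: All objects are smooth. $\mathbb R^\times=\mathbb R\setminus\{0\}$ is the multiplicative group. Precontact structure: a field of hyperplanes (smooth corank 1 distribution) $C\subset\mathsf TM$ such that $\nu^C:C\times_MC\to\mathsf TM/C$, $\nu^C(X,Y)=[X,Y]\bmod C$ for vector fields $X,Y$ in $C$, has constant rank. A contact vector field on $(M,C)$ is a vector field whose local flow preserves $C$. Presymplectic form: a closed 2-form $\omega$ of constant rank; $\chi(\omega)=\{X:i_X\omega=0\}$. A presymplectic $\mathbb R^\times$-bundle $(P,\tau,M,h,\omega)$ is a principal $\mathbb R^\times$-bundle $\tau:P\to M$ with action $h_s$ and a presymplectic form $\omega$ with $h_s^*\omega=s\,\omega$ such that $\chi(\omega)$ contains no nonzero $\tau$-vertical vectors. Its Euler vector field is $\nabla(x)=\frac{d}{dt}|_{t=0}h_{e^t}(x)$ and its Liouville 1-form is $\theta=i_\nabla\omega$. It is a presymplectic cover of $(M,C)$ if $C=\mathsf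 T\tau(\ker\theta)$. A function $H$ on $P$ is 1-homogeneous if $H\circ h_s=s\,H$ for all $s\in\mathbb R^\times$. A vector field $X$ on $P$ is a Hamiltonian vector field with Hamiltonian $H$ if $i_X\omega=-dH$. *)

(* Defs.v *)
From mathcomp Require Import all_boot all_order all_algebra.
From mathcomp Require Import all_classical all_reals all_analysis.
Import Order.TTheory GRing.Theory Num.Theory.
Import numFieldNormedType.Exports.

Set Implicit Arguments.
Unset Strict Implicit.
Unset Printing Implicit Defensive.

Local Open Scope classical_set_scope.
Local Open Scope ring_scope.

(* The library has no manifolds.  A manifold is given here by one chart around
   each point, and the tangent space at x is identified with R^n by means of
   the chart chosen at x.  Vectors, forms and distributions at x are written in
   that identification; [dcoord] and [dpar] below pass to any other chart, and
   smoothness is always tested in all the charts of the atlas. *)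

(* C^oo on an open set U: all the iterated directional derivatives of f
   exist and are differentiable (hence continuous) at every point of U. *)
Definition smooth_on (R : realType) (V W : normedModType R)
    (U : set V) (f : V -> W) : Prop :=
  forall (vs : seq V) (x : V), U x ->
    differentiable (foldr (fun v (g : V -> W) => 'D_v g) f vs) x.

Record chart (R : realType) (n : nat) (T : topologicalType) := Chart {
  dom : set T ;
  coords : T -> 'rV[R]_n ;
  par : 'rV[R]_n -> T ;
  dom_open : open dom ;
  image_open : open (coords @` dom) ;
  coordK : forall x, dom x -> par (coords x) = x ;
  coord_continuous : forall x, dom x -> {for x, continuous coords} ;
  par_continuous : forall u, (coords @` dom) u -> {for u, continuous par} }.

Record manifold (R : realType) (n : nat) := Manifold {
  points :> topologicalType ;
  chart_at : points -> chart R n points ;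
  chart_at_dom : forall x, dom (chart_at x) x ;
  chart_compatible : forall x y,
    smooth_on (coords (chart_at x) @` (dom (chart_at x) `&` dom (chart_at y)))
      (coords (chart_at y) \o par (chart_at x)) ;
  points_hausdorff : hausdorff_space points ;
  points_second_countable : @second_countable points }.

Section Manifolds.
Variable R : realType.

Definition chart_image n (M : manifold R n) (x : M) (U : set M) : set 'rV[R]_n :=
  coords (chart_at x) @` (dom (chart_at x) `&` U).

Definition base n (M : manifold R n) (x : M) : 'rV[R]_n := coords (chart_at x) x.

(* from an open subset W of a normed space to a manifold *)
Definition smooth_into (V : normedModType R) n (N : manifold R n)
    (W : set V) (g : V -> N) : Prop :=
  (forall v, W v -> {for v, continuous g}) /\
  forall y : N, smooth_on (W `&` g @^-1` dom (chart_at y))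
                          (coords (chart_at y) \o g).

(* from an open subset U of a manifold to a manifold *)
Definition smooth_map_on m n (M : manifold R m) (N : manifold R n)
    (U : set M) (f : M -> N) : Prop :=
  forall x : M, smooth_into (chart_image x U) (f \o par (chart_at x)).

(* from an open subset W of R x M to a manifold *)
Definition smooth_family_on m n (M : manifold R m) (N : manifold R n)
    (W : set (R * M)) (F : R -> M -> N) : Prop :=
  forall x : M,
    smooth_into [set p : R * 'rV[R]_m |
        chart_image x setT p.2 /\ W (p.1, par (chart_at x) p.2)]
      (fun p => F p.1 (par (chart_at x) p.2)).

(* from an open subset U of a manifold to a normed space *)
Definition smooth_fun_on n (M : manifold R n) (W : normedModType R)
    (U : set M) (f : M -> W) : Prop :=
  forall x : M, smooth_on (chart_image x U) (f \o par (chart_at x)).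

Definition smooth_fun n (M : manifold R n) (f : M -> R) : Prop :=
  smooth_fun_on setT f.

Definition tangent_map m n (M : manifold R m) (N : manifold R n)
    (f : M -> N) (x : M) : 'rV[R]_m -> 'rV[R]_n :=
  'd (coords (chart_at (f x)) \o f \o par (chart_at x)) (base x).

Definition dfun n (M : manifold R n) (W : normedModType R)
    (f : M -> W) (x : M) : 'rV[R]_n -> W :=
  'd (f \o par (chart_at x)) (base x).

(* the expression in the chart at y of a vector tangent at x *)
Definition dcoord n (M : manifold R n) (y x : M) : 'rV[R]_n -> 'rV[R]_n :=
  dfun (coords (chart_at y)) x.

(* the vector tangent at [par (chart_at y) u] expressed by a in the chart at y *)
Definition dpar n (M : manifold R n) (y : M) (u : 'rV[R]_n) :
    'rV[R]_n -> 'rV[R]_n :=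
  'd (coords (chart_at (par (chart_at y) u)) \o par (chart_at y)) u.

(* gamma'(t), a vector tangent at gamma t *)
Definition velocity n (M : manifold R n) (gamma : R -> M) (t : R) : 'rV[R]_n :=
  derive1 (coords (chart_at (gamma t)) \o gamma) t.

Definition vector_field n (M : manifold R n) := M -> 'rV[R]_n.
Definition one_form n (M : manifold R n) := M -> 'rV[R]_n -> R.
Definition two_form n (M : manifold R n) := M -> 'rV[R]_n -> 'rV[R]_n -> R.
Definition tangent_distribution n (M : manifold R n) := M -> set 'rV[R]_n.

Definition vf_local n (M : manifold R n) (X : vector_field M) (y : M)
    (u : 'rV[R]_n) : 'rV[R]_n :=
  dcoord y (par (chart_at y) u) (X (par (chart_at y) u)).

Definition one_form_local n (M : manifold R n) (theta : one_form M) (y : M)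
    (u a : 'rV[R]_n) : R :=
  theta (par (chart_at y) u) (dpar y u a).

Definition two_form_local n (M : manifold R n) (omega : two_form M) (y : M)
    (u a b : 'rV[R]_n) : R :=
  omega (par (chart_at y) u) (dpar y u a) (dpar y u b).

Definition smooth_vf_on n (M : manifold R n) (U : set M) (X : vector_field M) :=
  forall y : M, smooth_on (chart_image y U) (vf_local X y).

Definition smooth_vf n (M : manifold R n) (X : vector_field M) : Prop :=
  smooth_vf_on setT X.

Definition is_two_form n (M : manifold R n) (omega : two_form M) : Prop :=
  [/\ (forall x w, scalar (omega x ^~ w)),
      (forall x v, scalar (omega x v)),
      (forall x v, omega x v v = 0) &
      forall (y : M) (a b : 'rV[R]_n),
        smooth_on (chart_image y setT) (fun u => two_form_local omega y u a b)].

(* The exterior derivative (d omega)_x(a, b, c), computed in the chart at x,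
   where a, b, c extend to vector fields with constant coefficients. *)
Definition ext_deriv2 n (M : manifold R n) (omega : two_form M)
    (x : M) (a b c : 'rV[R]_n) : R :=
    'D_a (fun u => two_form_local omega x u b c) (base x)
  - 'D_b (fun u => two_form_local omega x u a c) (base x)
  + 'D_c (fun u => two_form_local omega x u a b) (base x).

(* [X, Y] = DY(X) - DX(Y) in the chart at x *)
Definition lie_bracket n (M : manifold R n) (X Y : vector_field M) :
    vector_field M := fun x =>
  'D_(X x) (vf_local Y x) (base x) - 'D_(Y x) (vf_local X x) (base x).

(* The Lie derivative in the chart at x:
   (L_X theta)_j = X^i d_i theta_j + theta_i d_j X^i. *)
Definition lie_derivative n (M : manifold R n) (X : vector_field M)
    (theta : one_form M) : one_form M := fun x v =>
    'D_(X x) (fun u => one_form_local theta x u v) (base x)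
  + theta x ('D_v (vf_local X x) (base x)).

Definition contract1 n (M : manifold R n) (X : vector_field M)
    (theta : one_form M) : M -> R := fun x => theta x (X x).

Definition contract2 n (M : manifold R n) (X : vector_field M)
    (omega : two_form M) : one_form M := fun x v => omega x (X x) v.

Definition has_dim n (S : set 'rV[R]_n) (k : nat) : Prop :=
  exists A : 'M[R]_(k, n), row_free A /\ S = [set v | (v <= A)%MS].

(* a vector subbundle of rank k: locally spanned by a smooth frame *)
Definition smooth_distribution n (M : manifold R n) (k : nat)
    (C : tangent_distribution M) : Prop :=
  forall x0 : M, exists (U : set M) (A : M -> 'M[R]_(k, n)),
    [/\ open U, U x0,
        (forall i, smooth_vf_on U (fun x => row i (A x))) &
        forall x, U x -> row_free (A x) /\ C x = [set v | (v <= A x)%MS]].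

Definition section_of n (M : manifold R n) (C : tangent_distribution M)
    (X : vector_field M) : Prop :=
  smooth_vf X /\ forall x, C x (X x).

(* The kernel at x of nu^C(X, Y) = [X, Y] mod C; the value of [X, Y] mod C at x
   depends only on X x and Y x, and every vector of C x extends to a section. *)
Definition nu_kernel n (M : manifold R n) (C : tangent_distribution M) (x : M) :
    set 'rV[R]_n :=
  [set v | C x v /\ forall X Y, section_of C X -> section_of C Y ->
                      X x = v -> C x (lie_bracket X Y x)].

(* The rank of nu^C at x is the rank of C minus the dimension of the kernel. *)
Definition precontact n (M : manifold R n) (C : tangent_distribution M) : Prop :=
  (exists2 k : nat, k.+1 = n & smooth_distribution k C) /\
  exists r : nat, forall x : M, has_dim (nu_kernel C x) r.

Definition local_flow n (M : manifold R n) (X : vector_field M)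
    (e : R) (U : set M) (phi : R -> M -> M) : Prop :=
  [/\ smooth_family_on [set p : R * M | `|p.1| < e /\ U p.2] phi,
      (forall x, U x -> phi 0 x = x) &
      forall t x, `|t| < e -> U x -> velocity (phi ^~ x) t = X (phi t x)].

(* Local flows exist and are unique, so that it is equivalent to ask that
   around each point some, or every, local flow of X preserves C. *)
Definition contact_vector_field n (M : manifold R n) (C : tangent_distribution M)
    (X : vector_field M) : Prop :=
  smooth_vf X /\
  forall x0 : M, exists (e : R) (U : set M) (phi : R -> M -> M),
    [/\ 0 < e, open U, U x0, local_flow X e U phi &
        forall t x, `|t| < e -> U x ->
          tangent_map (phi t) x @` C x = C (phi t x)].

(* An action of R^x is a function h : R -> P -> P of which only the values h s
   with s != 0 matter.  The last clause is local triviality: (x, s) |-> h s (sigma x) is an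
   equivariant diffeomorphism from U x R^x to tau^-1(U) with inverse (tau, u). *)
Definition principal_Rx_bundle p m (P : manifold R p) (M : manifold R m)
    (tau : P -> M) (h : R -> P -> P) : Prop :=
  [/\ smooth_map_on setT tau,
      smooth_family_on [set q : R * P | q.1 != 0] h,
      (forall x, h 1 x = x) /\
      (forall s t x, s != 0 -> t != 0 -> h s (h t x) = h (s * t) x),
      (forall s x, s != 0 -> tau (h s x) = tau x) &
      forall y0 : M, exists (U : set M) (sigma : M -> P) (u : P -> R),
        [/\ open U /\ U y0,
            smooth_map_on U sigma /\ smooth_fun_on (tau @^-1` U) u,
            (forall y, U y -> tau (sigma y) = y),
            (forall y s, U y -> s != 0 -> u (h s (sigma y)) = s) &
            forall x, U (tau x) -> u x != 0 /\ h (u x) (sigma (tau x)) = x]].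

Definition chi n (M : manifold R n) (omega : two_form M) : tangent_distribution M :=
  fun x => [set v | forall w, omega x v w = 0].

Definition presymplectic_form n (M : manifold R n) (omega : two_form M) : Prop :=
  [/\ is_two_form omega,
      (forall x a b c, ext_deriv2 omega x a b c = 0) &
      exists k : nat, forall x, has_dim (chi omega x) k].

Definition presymplectic_Rx_bundle p m (P : manifold R p) (M : manifold R m)
    (tau : P -> M) (h : R -> P -> P) (omega : two_form P) : Prop :=
  [/\ principal_Rx_bundle tau h,
      presymplectic_form omega,
      (forall s x v w, s != 0 ->
         omega (h s x) (tangent_map (h s) x v) (tangent_map (h s) x w)
         = s * omega x v w) &
      forall x v, chi omega x v -> tangent_map tau x v = 0 -> v = 0].

Definition euler_vf p (P : manifold R p) (h : R -> P -> P) : vector_field P :=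
  fun x => velocity (fun t => h (expR t) x) 0.

Definition liouville_form p (P : manifold R p) (h : R -> P -> P)
    (omega : two_form P) : one_form P := contract2 (euler_vf h) omega.

Definition presymplectic_cover p m (P : manifold R p) (M : manifold R m)
    (tau : P -> M) (h : R -> P -> P) (omega : two_form P)
    (C : tangent_distribution M) : Prop :=
  presymplectic_Rx_bundle tau h omega /\
  forall y w, C y w <->
    exists x v, [/\ tau x = y, liouville_form h omega x v = 0 &
                    tangent_map tau x v = w].

Definition invariant_vf p (P : manifold R p) (h : R -> P -> P)
    (X : vector_field P) : Prop :=
  forall s x, s != 0 -> tangent_map (h s) x (X x) = X (h s x).

Definition presymplectic_vf p (P : manifold R p) (h : R -> P -> P)
    (omega : two_form P) (X : vector_field P) : Prop :=
  [/\ smooth_vf X, invariant_vf h X &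
      forall x v, lie_derivative X (liouville_form h omega) x v = 0].

Definition homogeneous1 p (P : manifold R p) (h : R -> P -> P)
    (H : P -> R) : Prop :=
  forall s x, s != 0 -> H (h s x) = s * H x.

Definition hamiltonian_vf p (P : manifold R p) (omega : two_form P)
    (X : vector_field P) (H : P -> R) : Prop :=
  [/\ smooth_vf X, smooth_fun H &
      forall x v, contract2 X omega x v = - dfun H x v].

Definition projects_to p m (P : manifold R p) (M : manifold R m)
    (tau : P -> M) (X : vector_field P) (Xc : vector_field M) : Prop :=
  forall x, tangent_map tau x (X x) = Xc (tau x).

End Manifolds.

(* Main.v *)
(* The homogeneity [h_s^* omega = s omega] gives [L_E omega = omega] for the Euler field [E],
   hence [d theta = omega].  For an invariant [X] with [L_X theta = 0], Cartan's formula then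
   reads [i_X omega = - d (theta X)], and [theta X] is 1-homogeneous because [theta] is.
   Conversely a 1-homogeneous Hamiltonian satisfies [H = dH(E) = - omega(X, E) = theta X].

   For a contact field [Xc], [H] must be [theta] of any lift of [Xc], as [theta] vanishes on
   vertical vectors.  The velocity [Y] of a local lift of the flow of [Xc] satisfies
   [L_Y theta = 0] on [ker theta], because the flow preserves [C = T tau (ker theta)].  So
   [i_Y omega + dH = g theta] for a function [g], and [X = Y - g E] is a Hamiltonian lift of
   [Xc].  It is the only one at each point: the difference of two of them is vertical and in
   [chi omega], hence zero.  This pointwise uniqueness makes the local fields agree and gives
   the invariance of [X]. *)

Require Import Defs.
From mathcomp Require Import all_boot all_order all_algebra.
From mathcomp Require Import all_classical all_reals all_analysis.
From mathcomp Require Import ring.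
Import Order.TTheory GRing.Theory Num.Theory.
Import numFieldNormedType.Exports.

Set Implicit Arguments.
Unset Strict Implicit.
Unset Printing Implicit Defensive.

Local Open Scope classical_set_scope.
Local Open Scope ring_scope.

(** A tangent vector at [x] is written in the chart chosen at [x], so along a curve its components
    change with the chart and cannot be differentiated. Every derivative is therefore computed in
    one fixed chart, and [dcoord] and [dpar] translate between that chart and the points. In a fixed
    chart a Lie derivative is the time derivative of a pullback by a family of maps. It contains a
    mixed derivative in time and space, which is why the symmetry of second derivatives is
    established.

    The factor [g] exists because [theta] vanishes nowhere: [E] is vertical and nonzero, so it lies
    outside [chi omega]. Correcting by [E] works because [i_E omega = theta], and it leaves the
    projection unchanged because [E] is vertical.

    The flow of [E] reaches [h s] for positive [s] only, so differentiation along it says nothing of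
    negative [s]. Invariance under those elements rests on the pointwise uniqueness. *)

Local Notation coordsat y := (coords (chart_at y)).
Local Notation parat y := (par (chart_at y)).
Local Notation domat y := (dom (chart_at y)).

(** * Smooth functions on normed spaces *)

Section Calculus.
Variable R : realType.
Implicit Types V W : normedModType R.

Lemma near_eq_diff V W (f g : V -> W) (x : V) :
  (\forall y \near x, f y = g y) -> differentiable f x ->
  differentiable g x /\ 'd g x = 'd f x :> (V -> W).
Proof.
move=> fg df.
have dfc : continuous ('d f x) by exact: diff_continuous.
have exp : g \o shift x = cst (g x) + 'd f x +o_ 0 id.
  apply/eqaddoP => e e0.
  have /eqaddoP/(_ e e0) := diff_locally df.
  have fgx : f x = g x := nbhs_singleton fg.
  move: fg; rewrite (near_shift 0 x) /= => fg0.
  apply: filterS2 fg0 => y; rewrite /= !fctE /= subr0 => fgy.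
  by rewrite fgy fgx.
have dgE : 'd g x = 'd f x :> (V -> W) by exact: diff_unique.
by split=> //; apply/diff_locallyP; rewrite dgE.
Qed.

Lemma differentiable_mx V m n (f : V -> 'M[R]_(m, n)) x :
  (forall i j, differentiable (fun y => f y i j) x) -> differentiable f x.
Proof.
move=> df.
have -> : f = \sum_(i < m) \sum_(j < n) (fun y => f y i j *: delta_mx i j).
  apply/funext => y; rewrite fct_sumE [LHS]matrix_sum_delta.
  by apply: eq_bigr => i _; rewrite fct_sumE.
apply: differentiable_sum => i; apply: differentiable_sum => j.
exact: differentiableZl.
Qed.

Lemma differentiable_mx_coord V m n (f : V -> 'M[R]_(m, n)) x i j :
  differentiable f x -> differentiable (fun y => f y i j) x.
Proof.
move=> df.
exact: (@differentiable_comp _ _ _ _ f (fun N => N i j) _ df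
          (differentiable_coord _ _ _)).
Qed.

Lemma derive_mx_coord V m n (f : V -> 'M[R]_(m, n)) x v i j :
  differentiable f x -> 'D_v (fun y => f y i j) x = 'D_v f x i j.
Proof. by move=> df; rewrite derive_mx ?mxE //; exact: diff_derivable. Qed.

(** [smooth_on] speaks of all lists of directions at once. Cut at order [k], it can be proved by
    induction: the derivative of a product, an inverse or a composite is built from terms already
    controlled at the lower order. *)
Fixpoint diff_upto (k : nat) V W (U : set V) (f : V -> W) : Prop :=
  (forall x, U x -> differentiable f x) /\
  if k is k'.+1 then forall v, diff_upto k' U ('D_v f) else True.

Lemma smooth_onP V W (U : set V) (f : V -> W) :
  smooth_on U f <-> forall k, diff_upto k U f.
Proof.
split.
  move=> sf k; elim: k f sf => [|k IH] f sf /=.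
    by split=> // x Ux; exact: (sf [::]).
  split; first by move=> x Ux; exact: (sf [::]).
  (* In [foldr] the last direction of the list acts first on [f], so lists are extended and taken
     apart at the right end. *)
  move=> v; apply: IH => vs x Ux.
  by have := sf (rcons vs v) x Ux; rewrite foldr_rcons.
move=> sf vs; move: (sf (size vs)) => {sf}.
elim/last_ind: vs f => [|vs v IH] f /=; first by case.
rewrite size_rcons => -[_ /(_ v)/IH sf] x Ux.
by rewrite foldr_rcons; exact: sf.
Qed.

Lemma diff_uptoW k V W (U : set V) (f : V -> W) :
  diff_upto k.+1 U f -> diff_upto k U f.
Proof.
elim: k f => [|k IH] f; first by case.
by move=> [df dDf]; split=> // v; apply: IH; exact: dDf.
Qed.

Lemma open_near V (U : set V) (P : V -> Prop) x :
  open U -> (forall y, U y -> P y) -> U x -> \forall y \near x, P y.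
Proof.
move=> oU UP Ux; have : nbhs x U by exact: open_nbhs_nbhs.
by apply: filterS.
Qed.

(** Openness of [U] matters: the derivatives at a point of [U] depend on the values all around
    it. *)
Lemma eq_diff_upto k V W (U : set V) (f g : V -> W) : open U ->
  (forall x, U x -> f x = g x) -> diff_upto k U f -> diff_upto k U g.
Proof.
move=> oU; elim: k f g => [|k IH] f g fg /= [df dDf].
  by split=> // x Ux; apply: (near_eq_diff (open_near oU fg Ux) (df x Ux)).1.
split=> [x Ux|v]; first exact: (near_eq_diff (open_near oU fg Ux) (df x Ux)).1.
apply: IH (dDf v) => x Ux; apply: near_eq_derive.
exact: open_near fg Ux.
Qed.

Lemma sub_diff_upto k V W (U U' : set V) (f : V -> W) :
  U' `<=` U -> diff_upto k U f -> diff_upto k U' f.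
Proof.
move=> UU'; elim: k f => [|k IH] f /= [df dDf]; split=> //;
  by [move=> x /UU'; exact: df|move=> v; exact: IH].
Qed.

Lemma diff_upto_cst k V W (U : set V) (c : W) : diff_upto k U (cst c : V -> W).
Proof.
elim: k c => [|k IH] c; split=> // v.
have -> : 'D_v (cst c : V -> W) = cst 0 by apply/funext => x; rewrite derive_cst.
exact: IH.
Qed.

Lemma diff_uptoD k V W (U : set V) (f g : V -> W) : open U ->
  diff_upto k U f -> diff_upto k U g -> diff_upto k U (fun x => f x + g x).
Proof.
move=> oU; elim: k f g => [|k IH] f g [df dDf] [dg dDg]; split=> //.
- by move=> x Ux; apply: differentiableD; [exact: df|exact: dg].
- by move=> x Ux; apply: differentiableD; [exact: df|exact: dg].
move=> v; apply: (@eq_diff_upto _ _ _ _ (fun x => 'D_v f x + 'D_v g x)) => //.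
  by move=> x Ux; rewrite (deriveD (diff_derivable (df x Ux)) (diff_derivable (dg x Ux))).
by apply: IH; [exact: dDf|exact: dDg].
Qed.

Lemma diff_uptoM k V (U : set V) (f g : V -> R) : open U ->
  diff_upto k U f -> diff_upto k U g -> diff_upto k U (fun x => f x * g x).
Proof.
move=> oU; elim: k f g => [|k IH] f g.
  move=> [df dDf] [dg dDg]; split=> // x Ux.
  by apply: differentiableM; [exact: df|exact: dg].
move=> cf cg; have [df dDf] := cf; have [dg dDg] := cg.
split=> [x Ux|v].
  by apply: differentiableM; [exact: df|exact: dg].
apply: (@eq_diff_upto _ _ _ _ (fun x => f x * 'D_v g x + g x * 'D_v f x)) => //.
  by move=> x Ux; rewrite (deriveM (diff_derivable (df x Ux)) (diff_derivable (dg x Ux))).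
apply: diff_uptoD => //; apply: IH;
  by [exact: diff_uptoW cf|exact: diff_uptoW cg|exact: dDf|exact: dDg].
Qed.

Lemma diff_uptoV k V (U : set V) (f : V -> R) : open U ->
  (forall x, U x -> f x != 0) ->
  diff_upto k U f -> diff_upto k U (fun x => (f x)^-1).
Proof.
move=> oU f0; elim: k => [|k IH].
  by move=> [df _]; split=> // x Ux; apply: differentiableV; [exact: df|exact: f0].
move=> cf; have [df dDf] := cf; split=> [x Ux|v].
  by apply: differentiableV; [exact: df|exact: f0].
apply: (@eq_diff_upto _ _ _ _
   (fun x => (-1) * ((f x)^-1 * (f x)^-1) * 'D_v f x)) => //.
  move=> x Ux; rewrite deriveV ?f0 //; last exact/diff_derivable/df.
  by rewrite expr2 invfM /GRing.scale /=; ring.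
have cV := IH (diff_uptoW cf).
apply: diff_uptoM => //; last exact: dDf.
by apply: diff_uptoM => //; [exact: diff_upto_cst|exact: diff_uptoM].
Qed.

Lemma diff_upto_sum k V W (U : set V) (I : Type) (r : seq I) (F : I -> V -> W) :
  open U -> (forall i, diff_upto k U (F i)) ->
  diff_upto k U (fun x => \sum_(i <- r) F i x).
Proof.
move=> oU dF; elim: r => [|i r IH].
  apply: (@eq_diff_upto _ _ _ _ (cst 0)) => //; last exact: diff_upto_cst.
  by move=> x _; rewrite big_nil.
apply: (@eq_diff_upto _ _ _ _ (fun x => F i x + \sum_(j <- r) F j x)) => //.
  by move=> x _; rewrite big_cons.
exact: diff_uptoD.
Qed.

Lemma diff_upto_mxP k V m n (U : set V) (f : V -> 'M[R]_(m, n)) : open U ->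
  diff_upto k U f <-> forall i j, diff_upto k U (fun x => f x i j).
Proof.
move=> oU; split.
  elim: k f => [|k IH] f [df dDf] i j.
    by split=> // x Ux; apply: differentiable_mx_coord; exact: df.
  split=> [x Ux|v]; first by apply: differentiable_mx_coord; exact: df.
  apply: (@eq_diff_upto _ _ _ _ (fun x => 'D_v f x i j)) => //.
    by move=> x Ux; rewrite derive_mx_coord //; exact: df.
  by apply: IH; exact: dDf.
elim: k f => [|k IH] f df.
  by split=> // x Ux; apply: differentiable_mx => i j; exact: (df i j).1.
have dif x : U x -> differentiable f x.
  by move=> Ux; apply: differentiable_mx => i j; exact: (df i j).1.
split=> // v; apply: IH => i j.
apply: (@eq_diff_upto _ _ _ _ ('D_v (fun x => f x i j))) => //.
  by move=> x Ux; rewrite derive_mx_coord //; exact: dif.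
exact: (df i j).2.
Qed.

(** A map that is its own differential gives ['D_v (g \o L) = 'D_(L v) g \o L], again a composite
    with [L], so the induction closes without products. *)
Lemma diff_upto_lin k V V' W (L : V -> V') (U : set V) (U' : set V')
    (g : V' -> W) : open U ->
  (forall x, differentiable L x) -> (forall x, 'd L x = L :> (V -> V')) ->
  (forall x, U x -> U' (L x)) -> diff_upto k U' g -> diff_upto k U (g \o L).
Proof.
move=> oU difL dL UU'; elim: k g => [|k IH] g [dg dDg].
  by split=> // x Ux; apply: differentiable_comp => //; apply: dg; exact: UU'.
split=> [x Ux|v]; first by apply: differentiable_comp => //; apply: dg; exact: UU'.
apply: (@eq_diff_upto _ _ _ _ ('D_(L v) g \o L)) => //; last exact/IH/dDg.
move=> x Ux; have dgx : differentiable g (L x) by apply: dg; exact: UU'.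
rewrite [RHS]deriveE; last exact: differentiable_comp.
by rewrite diff_comp //= dL [LHS]deriveE.
Qed.

(** The chain rule differentiates along a direction that moves with the point. Expansion on a fixed
    basis replaces it by finitely many fixed directions with smooth coefficients, to which the
    induction of [diff_upto_pair_comp] applies. *)
Lemma pair_rV_sum n (a : R) (w : 'rV[R]_n) :
  (a, w) = a *: ((1, 0) : R * 'rV[R]_n) +
     \sum_(j < n) w 0 j *: ((0, delta_mx 0 j) : R * 'rV[R]_n).
Proof.
have -> : \sum_(j < n) w 0 j *: ((0, delta_mx 0 j) : R * 'rV[R]_n) = (0, w).
  rewrite [in RHS](row_sum_delta w).
  elim/big_rec2: _ => // j y z _ ->.
  by congr pair; rewrite /= scaler0 addr0.
by congr pair; rewrite /= ?scaler0 ?add0r // addr0 [RHS]mulr1.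
Qed.

(** The inner map has a real component besides the vector one so that time-dependent families are
    covered; a constant first component gives the ordinary composition rule. *)
Lemma diff_upto_pair_comp k V n (U : set V) (U' : set (R * 'rV[R]_n))
    (s : V -> R) (c : V -> 'rV[R]_n) (g : R * 'rV[R]_n -> R) : open U ->
  (forall x, U x -> U' (s x, c x)) ->
  diff_upto k U s -> diff_upto k U c -> diff_upto k U' g ->
  diff_upto k U (fun x => g (s x, c x)).
Proof.
move=> oU UU'; elim: k g => [|k IH] g cs cc cg.
  split=> // x Ux.
  apply: (@differentiable_comp _ _ _ _ (fun x => (s x, c x)) g).
    by apply: differentiable_pair; [case: cs|case: cc] => + _; apply.
  by case: cg => dg _; apply: dg; exact: UU'.
have ds x : U x -> differentiable s x by case: cs => + _; apply.
have dc x : U x -> differentiable c x by case: cc => + _; apply.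
have dg x : U x -> differentiable g (s x, c x) by move=> /UU' Ux; case: cg => + _; apply.
have dp x : U x -> differentiable (fun x => (s x, c x)) x.
  by move=> Ux; apply: differentiable_pair; [exact: ds|exact: dc].
split=> [x Ux|v].
  by apply: (@differentiable_comp _ _ _ _ (fun x => (s x, c x)) g);
    [exact: dp|exact: dg].
apply: (@eq_diff_upto _ _ _ _ (fun x => 'D_v s x * 'D_(1, 0) g (s x, c x) +
   \sum_(j < n) 'D_v (fun x => c x 0 j) x * 'D_(0, delta_mx 0 j) g (s x, c x)))
  => //.
  move=> x Ux; rewrite [RHS]deriveE; last first.
    by apply: (@differentiable_comp _ _ _ _ (fun x => (s x, c x)) g);
      [exact: dp|exact: dg].
  rewrite (@diff_comp _ _ _ _ (fun x => (s x, c x)) g); [|exact: dp|exact: dg].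
  rewrite /= diff_pair; [|exact: ds|exact: dc].
  have -> : ('d s x v, 'd c x v) =
     'd s x v *: ((1, 0) : R * 'rV[R]_n) +
     \sum_(j < n) ('d c x v) 0 j *: ((0, delta_mx 0 j) : R * 'rV[R]_n).
    exact: pair_rV_sum.
  rewrite linearD linearZ /= linear_sum /= deriveE; last exact: ds.
  rewrite (deriveE _ (dg _ Ux)); congr (_ + _).
  apply: eq_bigr => j _; rewrite linearZ /= (deriveE _ (dg _ Ux)).
  by rewrite derive_mx_coord ?deriveE //; exact: dc.
have cDg w := IH _ (diff_uptoW cs) (diff_uptoW cc) (cg.2 w).
apply: diff_uptoD => //; first by apply: diff_uptoM => //; exact: cs.2.
apply: diff_upto_sum => // j; apply: diff_uptoM => //.
exact: ((diff_upto_mxP _ _ oU).1 cc 0 j).2.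
Qed.

End Calculus.

(** * Symmetry of second derivatives *)

Section Schwarz.
Variable R : realType.
Variable V : normedModType R.
Implicit Types f : V -> R.

Lemma is_derive_line (f : V -> R) (v y : V) (c : R) :
  differentiable f (c *: v + y) ->
  is_derive c 1 (fun s : R => f (s *: v + y)) ('D_v f (c *: v + y)).
Proof.
move=> df.
have dl : is_diff c (fun s : R => s *: v + y) ( *:%R ^~ v).
  apply: (@is_diff_eq _ _ _ _ _ _ _ (is_diffD (is_diff_scalel c v) (is_diff_cst y c))).
  by apply/funext => s; rewrite !fctE addr0.
have dfl : differentiable (f \o (fun s : R => s *: v + y)) c.
  by apply: differentiable_comp => //; exact: ex_diff.
apply: DeriveDef; first exact: diff_derivable.
rewrite deriveE // (diff_comp (@ex_diff _ _ _ _ _ _ _ dl)) //=.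
by rewrite (@diff_val _ _ _ _ _ _ _ dl) scale1r deriveE.
Qed.

(** The mean value theorem along [v] turns the second difference into [h] times an increment of
    ['D_v f] between two points at distance O(h) from [x]; differentiability of ['D_v f] at [x]
    evaluates that increment up to o(h). *)
Lemma second_difference f (x v w : V) (e : R) : 0 < e ->
  (\forall y \near x, differentiable f y) -> differentiable ('D_v f) x ->
  \forall h \near 0^'+,
    `|f (h *: v + (h *: w + x)) - f (h *: v + x) - (f (h *: w + x) - f x)
      - h ^+ 2 * 'd ('D_v f) x w| <= e * h ^+ 2 * (2 * `|v| + `|w|).
Proof.
move=> e0 df ddf.
set L := 'd ('D_v f) x.
have /eqaddoP/(_ e e0) := diff_locally ddf.
rewrite -/L => Lo; move: df.
rewrite (near_shift 0 x) /= => df0.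
have /nbhs_norm0P[r /= r0 Hr] := @filterI _ _ (nbhs_filter (0 : V)) _ _ df0 Lo.
have {}Hr z : `|z| < r -> differentiable f (z + x) /\
    `|'D_v f (z + x) - 'D_v f x - L z| <= e * `|z|.
  move=> zr; have [] := Hr z zr.
  by rewrite subr0 !fctE /= opprD addrA.
have N0 : 0 < `|v| + `|w| + 1 by rewrite ltr_wpDl// addr_ge0.
near=> h.
have h0 : 0 < h by near: h; exact: nbhs_right_gt.
have hr : h * (`|v| + `|w| + 1) < r.
  rewrite -ltr_pdivlMr //; near: h; apply: nbhs_right_lt.
  by rewrite divr_gt0.
have bound c : 0 <= c <= h ->
    `|c *: v + h *: w| <= h * (`|v| + `|w|) /\ `|c *: v| <= h * `|v|.
  move=> /andP[c0 ch]; split; last by rewrite normrZ ger0_norm // ler_wpM2r.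
  rewrite mulrDr (le_trans (ler_normD _ _)) // !normrZ (ger0_norm c0).
  by rewrite (gtr0_norm h0) lerD2r ler_wpM2r.
have small c : 0 <= c <= h -> `|c *: v + h *: w| < r /\ `|c *: v| < r.
  move=> /bound[b1 b2]; split.
    by apply: le_lt_trans b1 (le_lt_trans _ hr); rewrite ler_pM2l // lerDl.
  apply: le_lt_trans b2 (le_lt_trans _ hr).
  by rewrite ler_pM2l // -addrA lerDl addr_ge0.
(* The increment of [f] by [h *: w], as a function of the position along [v]; the second difference
   is [phi h - phi 0]. *)
pose phi s := f (s *: v + (h *: w + x)) - f (s *: v + x).
have dphi s : 0 <= s <= h -> is_derive s 1 phi
    ('D_v f (s *: v + (h *: w + x)) - 'D_v f (s *: v + x)).
  move=> /small[s1 s2].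
  apply: is_deriveB; apply: is_derive_line.
    by rewrite addrA; exact: (Hr _ s1).1.
  exact: (Hr _ s2).1.
have [|||c] := @MVT_segment R phi
    (fun s => 'D_v f (s *: v + (h *: w + x)) - 'D_v f (s *: v + x)) 0 h.
- exact: ltW.
- move=> s; rewrite in_itv /= => /andP[s0 sh]; apply: dphi.
  by rewrite !ltW.
- apply: derivable_within_continuous => s; rewrite in_itv /= => sh.
  by have [] := dphi _ sh.
rewrite in_itv /= => ch; rewrite subr0 {1 2}/phi scale0r !add0r => ->.
have [s1 s2] := small _ ch; have [b1 b2] := bound _ ch.
have [_ H1] := Hr _ s1; have [_ H2] := Hr _ s2.
rewrite (addrA _ _ x).
(* The unknown point [c] of the mean value theorem cancels: [L (h *: w)] is the difference of the
   linear parts at [c *: v + h *: w] and at [c *: v]. *)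
have -> : ('D_v f (c *: v + h *: w + x) - 'D_v f (c *: v + x)) * h -
    h ^+ 2 * L w = h * (('D_v f (c *: v + h *: w + x) - 'D_v f x - L (c *: v + h *: w))
      - ('D_v f (c *: v + x) - 'D_v f x - L (c *: v))).
  rewrite linearD [L (h *: w)]linearZ /= /GRing.scale /=; ring.
rewrite normrM (gtr0_norm h0) expr2.
have -> : e * (h * h) * (2 * `|v| + `|w|) =
  h * (e * (h * (`|v| + `|w|)) + e * (h * `|v|)) by ring.
rewrite ler_pM2l //; apply: le_trans (ler_normB _ _) _.
by rewrite lerD //; [apply: le_trans H1 _|apply: le_trans H2 _]; rewrite ler_pM2l.
Unshelve. all: by end_near. Qed.

(** The second difference is symmetric in [v] and [w], and divided by [h ^+ 2] it approximates
    either mixed derivative. *)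
Lemma derive_comm f (x v w : V) :
  (\forall y \near x, differentiable f y) ->
  differentiable ('D_v f) x -> differentiable ('D_w f) x ->
  'D_w ('D_v f) x = 'D_v ('D_w f) x.
Proof.
move=> df dv dw; rewrite !deriveE //.
apply/eqP; rewrite -subr_eq0 -normr_le0; apply/ler_addgt0Pl => e e0.
rewrite addr0.
(* The sum of the constants in the two error bounds; the added 1 keeps it positive when [v] and [w]
   are both zero. *)
pose N := (2 * `|v| + `|w|) + (2 * `|w| + `|v|) + 1.
have N0 : 0 < N by rewrite ltr_wpDl // !addr_ge0 // mulr_ge0.
have eN : 0 < e / N by rewrite divr_gt0.
near (0 : R)^'+ => h.
have h0 : 0 < h by near: h; exact: nbhs_right_gt.
have H1 : `|f (h *: v + (h *: w + x)) - f (h *: v + x) - (f (h *: w + x) - f x)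
      - h ^+ 2 * 'd ('D_v f) x w| <= e / N * h ^+ 2 * (2 * `|v| + `|w|).
  by near: h; exact: second_difference.
have H2 : `|f (h *: w + (h *: v + x)) - f (h *: w + x) - (f (h *: v + x) - f x)
      - h ^+ 2 * 'd ('D_w f) x v| <= e / N * h ^+ 2 * (2 * `|w| + `|v|).
  by near: h; exact: second_difference.
have h2 : 0 < h ^+ 2 by rewrite exprn_gt0.
rewrite -(ler_pM2l h2) -{1}(gtr0_norm h2) -normrM.
have -> : h ^+ 2 * ('d ('D_v f) x w - 'd ('D_w f) x v) =
  (f (h *: w + (h *: v + x)) - f (h *: w + x) - (f (h *: v + x) - f x)
      - h ^+ 2 * 'd ('D_w f) x v) -
  (f (h *: v + (h *: w + x)) - f (h *: v + x) - (f (h *: w + x) - f x)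
      - h ^+ 2 * 'd ('D_v f) x w).
  by rewrite (addrCA (h *: w)); ring.
apply: le_trans (ler_normB _ _) _; apply: le_trans (lerD H2 H1) _.
rewrite -mulrDr (mulrC (e / N)) -mulrA ler_pM2l // mulrAC ler_pdivrMr //.
by rewrite ler_pM2l // /N addrC lerDl.
Unshelve. all: by end_near. Qed.

End Schwarz.

(** * Germs of smooth functions *)

Section Germs.
Variable R : realType.
Implicit Types V W : normedModType R.

(** One neighbourhood serves all orders. Passing to germs spares the bookkeeping of domains when
    functions are composed or divided. *)
Definition smooth_near V W (f : V -> W) (x : V) : Prop :=
  exists2 U : set V, open U /\ U x & forall k, diff_upto k U f.

Lemma smooth_on_near V W (U : set V) (f : V -> W) x :
  open U -> smooth_on U f -> U x -> smooth_near f x.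
Proof. by move=> oU /smooth_onP sf Ux; exists U. Qed.

Lemma smooth_near_on V W (U : set V) (f : V -> W) :
  (forall x, U x -> smooth_near f x) -> smooth_on U f.
Proof.
move=> sf vs x Ux; have [A [oA Ax] /smooth_onP sA] := sf x Ux.
exact: sA.
Qed.

Lemma smooth_near_diff V W (f : V -> W) x : smooth_near f x -> differentiable f x.
Proof. by move=> [U [oU Ux] /(_ 0%N)[df _]]; exact: df. Qed.

Lemma smooth_near_near V W (f : V -> W) x :
  smooth_near f x -> \forall y \near x, smooth_near f y.
Proof.
move=> [U [oU Ux] sf]; apply: (open_near oU) Ux => y Uy.
by exists U.
Qed.

Lemma smooth_near_continuous V W (f : V -> W) x :
  smooth_near f x -> {for x, continuous f}.
Proof. by move=> /smooth_near_diff; exact: differentiable_continuous. Qed.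

Lemma smooth_near_derive V W (f : V -> W) x v :
  smooth_near f x -> smooth_near ('D_v f) x.
Proof.
move=> [U Ux sf]; exists U => // k; exact: (sf k.+1).2.
Qed.

Lemma smooth_near_restr V W (f : V -> W) x (A : set V) : nbhs x A ->
  (forall U : set V, open U -> U `<=` A -> forall k, diff_upto k U f) ->
  smooth_near f x.
Proof.
move=> xA fA; exists A°; first by split; [exact: open_interior|].
exact: (fA _ (@open_interior _ A) (@interior_subset _ A)).
Qed.

Lemma eq_smooth_near V W (f g : V -> W) x :
  (\forall y \near x, f y = g y) -> smooth_near f x -> smooth_near g x.
Proof.
move=> fg [U [oU Ux] sf].
apply: (@smooth_near_restr _ _ _ _ ([set y | f y = g y] `&` U)).
  by apply: filterI => //; exact: open_nbhs_nbhs.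
move=> B oB; rewrite subsetI => -[Bfg BU] k; apply: (@eq_diff_upto _ _ _ _ _ f) => //.
exact: sub_diff_upto BU (sf k).
Qed.

Lemma smooth_near_cst V W (c : W) (x : V) : smooth_near (fun=> c) x.
Proof.
exists setT => [|k]; last exact: diff_upto_cst.
by split=> //; exact: openT.
Qed.

Lemma smooth_near2 V W1 W2 W3 (f1 : V -> W1) (f2 : V -> W2) (f3 : V -> W3) x :
  (forall k U, open U -> diff_upto k U f1 -> diff_upto k U f2 ->
     diff_upto k U f3) ->
  smooth_near f1 x -> smooth_near f2 x -> smooth_near f3 x.
Proof.
move=> f123 [U1 [oU1 U1x] sf1] [U2 [oU2 U2x] sf2].
exists (U1 `&` U2); first by split=> //; exact: openI.
move=> k; apply: f123; first exact: openI.
  by apply: sub_diff_upto (sf1 k) => y [].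
by apply: sub_diff_upto (sf2 k) => y [].
Qed.

Lemma smooth_nearD V W (f g : V -> W) x : smooth_near f x -> smooth_near g x ->
  smooth_near (fun y => f y + g y) x.
Proof. by apply: smooth_near2 => k U; exact: diff_uptoD. Qed.

Lemma smooth_nearM V (f g : V -> R) x : smooth_near f x -> smooth_near g x ->
  smooth_near (fun y => f y * g y) x.
Proof. by apply: smooth_near2 => k U; exact: diff_uptoM. Qed.

Lemma smooth_nearV V (f : V -> R) x : smooth_near f x -> f x != 0 ->
  smooth_near (fun y => (f y)^-1) x.
Proof.
move=> sf f0; have [U [oU Ux] sU] := sf.
apply: (@smooth_near_restr _ _ _ _ ([set y | f y != 0] `&` U)).
  apply: filterI; last exact: open_nbhs_nbhs.
  have := smooth_near_continuous sf.
  by move/(_ [set z | z != 0]); apply; apply: open_nbhs_nbhs; split => //;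
    exact: open_neq.
move=> B oB; rewrite subsetI => -[Bf BU] k; apply: diff_uptoV => //.
exact: sub_diff_upto BU (sU k).
Qed.

Lemma smooth_near_sum V W (I : Type) (r : seq I) (F : I -> V -> W) x :
  (forall i, smooth_near (F i) x) ->
  smooth_near (fun y => \sum_(i <- r) F i y) x.
Proof.
move=> sF; elim: r => [|i r IH].
  apply: (@eq_smooth_near _ _ (cst 0)); last exact: smooth_near_cst.
  by near=> y; rewrite big_nil.
apply: (@eq_smooth_near _ _ (fun y => F i y + \sum_(j <- r) F j y)).
  by near=> y; rewrite big_cons.
exact: smooth_nearD.
Unshelve. all: by end_near. Qed.

Lemma smooth_near_coord V m n (f : V -> 'M[R]_(m, n)) x i j :
  smooth_near f x -> smooth_near (fun y => f y i j) x.
Proof.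
by move=> [U [oU Ux] sf]; exists U => // k; apply: (diff_upto_mxP _ _ oU).1.
Qed.

Lemma smooth_near_mx V m n (f : V -> 'M[R]_(m, n)) x :
  (forall i j, smooth_near (fun y => f y i j) x) -> smooth_near f x.
Proof.
move=> sf.
pose A := [set y | forall p : 'I_m * 'I_n, smooth_near (fun y => f y p.1 p.2) y].
apply: (@smooth_near_restr _ _ _ _ A).
  by apply: filter_forall => p; exact: smooth_near_near.
move=> U oU UA k; apply/(diff_upto_mxP _ _ oU) => i j.
by move: k; apply/smooth_onP/smooth_near_on => y /UA/(_ (i, j)).
Qed.

Lemma smooth_near_lin V V' W (L : V -> V') (g : V' -> W) x :
  (forall y, is_diff y L L) ->
  smooth_near g (L x) -> smooth_near (g \o L) x.
Proof.
move=> dL [U [oU Ux] sg].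
have oLU : open (L @^-1` U).
  by apply: open_comp oU => y _; exact/differentiable_continuous/ex_diff.
exists (L @^-1` U) => // k.
by apply: (diff_upto_lin _ _ _ _ (sg k)) => // y; exact: diff_val.
Qed.

Lemma smooth_near_pair_comp V n (s : V -> R) (c : V -> 'rV[R]_n)
    (g : R * 'rV[R]_n -> R) x :
  smooth_near s x -> smooth_near c x -> smooth_near g (s x, c x) ->
  smooth_near (fun y => g (s y, c y)) x.
Proof.
move=> ss sc [U' [oU' U'x] sg].
have [Us [oUs Usx] sUs] := ss; have [Uc [oUc Ucx] sUc] := sc.
apply: (@smooth_near_restr _ _ _ _ ([set y | U' (s y, c y)] `&` (Us `&` Uc))).
  apply: filterI; last by apply: filterI; exact: open_nbhs_nbhs.
  have : {for x, continuous (fun y => (s y, c y))}.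
    apply: differentiable_continuous.
    by apply: differentiable_pair; exact: smooth_near_diff.
  by move/(_ U'); apply; exact: open_nbhs_nbhs.
move=> B oB ; rewrite !subsetI => -[BU' [Bs Bc]] k.
apply: (@diff_upto_pair_comp _ _ _ _ _ U' s c g) => //.
- exact: sub_diff_upto Bs (sUs k).
- exact: sub_diff_upto Bc (sUc k).
Qed.

Lemma smooth_near_pair_comp_mx V p q n (s : V -> R) (c : V -> 'rV[R]_n)
    (g : R * 'rV[R]_n -> 'M[R]_(p, q)) x :
  smooth_near s x -> smooth_near c x -> smooth_near g (s x, c x) ->
  smooth_near (fun y => g (s y, c y)) x.
Proof.
move=> ss sc sg; apply: smooth_near_mx => i j.
apply: (@smooth_near_pair_comp _ _ _ _ (fun z => g z i j)) => //.
exact: smooth_near_coord.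
Qed.

Lemma is_diff_snd V W (x : V * W) : is_diff x snd snd.
Proof.
by apply: DiffDef; [apply: linear_differentiable|apply: diff_lin] => y;
  exact: cvg_snd.
Qed.

Lemma is_diff_fst V W (x : V * W) : is_diff x fst fst.
Proof.
by apply: DiffDef; [apply: linear_differentiable|apply: diff_lin] => y;
  exact: cvg_fst.
Qed.

Lemma smooth_near_comp V n (c : V -> 'rV[R]_n) (g : 'rV[R]_n -> R) x :
  smooth_near c x -> smooth_near g (c x) -> smooth_near (g \o c) x.
Proof.
move=> sc sg.
apply: (@smooth_near_pair_comp _ _ (cst 0) c (g \o snd)) => //.
  exact: smooth_near_cst.
by apply: smooth_near_lin => //= y; exact: is_diff_snd.
Qed.

Lemma smooth_near_comp_mx V p q n (c : V -> 'rV[R]_n)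
    (g : 'rV[R]_n -> 'M[R]_(p, q)) x :
  smooth_near c x -> smooth_near g (c x) -> smooth_near (g \o c) x.
Proof.
move=> sc sg; apply: smooth_near_mx => i j.
by apply: (@smooth_near_comp _ _ _ (fun z => g z i j)) => //; exact: smooth_near_coord.
Qed.

Lemma smooth_near_linear V W (L : V -> W) x :
  (forall y, is_diff y L L) -> smooth_near L x.
Proof.
move=> dL; exists setT; first by split=> //; exact: openT.
case=> [|k]; split=> // v.
have -> : 'D_v L = cst (L v).
  by apply/funext => y; rewrite deriveE // diff_val.
exact: diff_upto_cst.
Qed.

Lemma smooth_near_id V (x : V) : smooth_near (fun y : V => y) x.
Proof. exact: (@smooth_near_linear V V id x (fun y => is_diff_id y)). Qed.

Lemma smooth_near_expR (x : R) : smooth_near (@expR R) x.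
Proof.
exists setT; first by split=> //; exact: openT.
have dexp y : differentiable (@expR R) y.
  exact/derivable1_diffP/derivable_expR.
elim=> [|k IH]; split=> // v.
have -> : 'D_v (@expR R) = (fun y => v * expR y).
  apply/funext => y; by rewrite deriveE // diff1E // derive1E derive_val.
by apply: diff_uptoM => //; [exact: openT|exact: diff_upto_cst].
Qed.

Lemma smooth_near_derive_comm V (f : V -> R) x v w : smooth_near f x ->
  'D_w ('D_v f) x = 'D_v ('D_w f) x.
Proof.
move=> sf; apply: derive_comm.
- by apply: filterS (smooth_near_near sf) => y; exact: smooth_near_diff.
- exact/smooth_near_diff/smooth_near_derive.
- exact/smooth_near_diff/smooth_near_derive.
Qed.

Lemma smooth_near_derive_comm_mx V m n (f : V -> 'M[R]_(m, n)) x v w :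
  smooth_near f x -> 'D_w ('D_v f) x = 'D_v ('D_w f) x.
Proof.
move=> sf; apply/matrixP => i j.
have E a b : ('D_a ('D_b f) x) i j = 'D_a ('D_b (fun y => f y i j)) x.
  rewrite -derive_mx_coord; last exact/smooth_near_diff/smooth_near_derive.
  apply: near_eq_derive; apply: filterS (smooth_near_near sf) => y sy.
  by rewrite derive_mx_coord //; exact: smooth_near_diff.
apply: etrans (E w v) _; apply: esym; apply: etrans (E v w) _.
exact: (smooth_near_derive_comm _ _ (smooth_near_coord i j sf)).
Qed.

Lemma smooth_nearZ V n (f : V -> R) (g : V -> 'rV[R]_n) v :
  smooth_near f v -> smooth_near g v -> smooth_near (fun w => f w *: g w) v.
Proof.
move=> sf sg; apply: smooth_near_mx => i j.
apply: (@eq_smooth_near _ _ (fun w => f w * g w i j)).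
  by near=> w; rewrite mxE.
by apply: smooth_nearM => //; exact: smooth_near_coord.
Unshelve. all: by end_near. Qed.

Lemma is_derive_expRM (k : R) : is_derive (0 : R) 1 (fun t : R => expR t * k) k.
Proof.
have D := deriveM (@derivable_expR R 0) (derivable_cst k (0 : R) 1).
apply: DeriveDef; first exact: derivableM.
apply: etrans D _; rewrite derive_cst scaler0 add0r derive_val expR0.
exact: mulr1.
Qed.

End Germs.

(** * Smooth maps and their differentials in charts *)

Section ManifoldCalculus.
Variable R : realType.
Implicit Types V : normedModType R.

Lemma open_chart_image n (M : manifold R n) (y : M) (U : set M) :
  open U -> open (chart_image y U).
Proof.
move=> oU; rewrite openE => u [x [dx Ux] <-].
have imx : (coordsat y @` domat y) (coordsat y x) by exists x.
have := par_continuous imx; rewrite /prop_for /continuous_at coordK // => parc.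
have nI : nbhs (coordsat y x) (coordsat y @` domat y).
  by apply: open_nbhs_nbhs; split=> //; exact: image_open.
have nU : nbhs (coordsat y x) (parat y @^-1` U).
  by apply: parc; apply: open_nbhs_nbhs; split.
apply: filterS2 nI nU => _ [z dz <-]; rewrite /preimage /= coordK // => Uz.
by exists z.
Qed.

Lemma chart_imageT n (M : manifold R n) (y x : M) (U : set M) :
  domat y x -> U x -> chart_image y U (coordsat y x).
Proof. by move=> dx Ux; exists x. Qed.

Lemma near_dom n (M : manifold R n) (y x : M) :
  domat y x -> \forall z \near x, domat y z.
Proof.
by move=> dx; apply: open_nbhs_nbhs; split=> //; exact: dom_open.
Qed.

Lemma par_cvg n (M : manifold R n) (y x : M) :
  domat y x -> parat y @ coordsat y x --> x.
Proof.
move=> dx; have imx : (coordsat y @` domat y) (coordsat y x) by exists x.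
by have := par_continuous imx; rewrite /prop_for /continuous_at coordK.
Qed.

Lemma near_par n (M : manifold R n) (y x : M) (Q : M -> Prop) : domat y x ->
  (\forall z \near x, Q z) -> \forall u \near coordsat y x, Q (parat y u).
Proof. by move=> dx Qx; exact: par_cvg dx _ Qx. Qed.

Lemma near_parK n (M : manifold R n) (y x : M) : domat y x ->
  \forall u \near coordsat y x, domat y (parat y u) /\ coordsat y (parat y u) = u.
Proof.
move=> dx.
have nI : nbhs (coordsat y x) (coordsat y @` domat y).
  by apply: open_nbhs_nbhs; split; [exact: image_open|exists x].
by apply: filterS nI => _ [z dz <-]; rewrite coordK.
Qed.

(** Continuity is asked separately because [coordsat c] is arbitrary outside [domat c]: smoothness
    of [coordsat c \o g] alone does not keep [g] inside the chart. *)
Definition smooth_germ V n (N : manifold R n) (g : V -> N) (v : V) : Prop :=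
  (\forall w \near v, {for w, continuous g}) /\
  exists2 c : N, domat c (g v) & smooth_near (coordsat c \o g) v.

Lemma smooth_germ_continuous V n (N : manifold R n) (g : V -> N) v :
  smooth_germ g v -> {for v, continuous g}.
Proof. by case=> /nbhs_singleton. Qed.

Lemma smooth_germ_near V n (N : manifold R n) (g : V -> N) v (Q : N -> Prop) :
  smooth_germ g v -> (\forall y \near g v, Q y) -> \forall w \near v, Q (g w).
Proof. by move=> /smooth_germ_continuous gc Qg; exact: gc Q Qg. Qed.

(** Near [v], the expression of [g] in the chart at [y] is a transition map applied to its
    expression in the chart at [c]. *)
Lemma smooth_germ_coords V n (N : manifold R n) (g : V -> N) v y :
  smooth_germ g v -> domat y (g v) -> smooth_near (coordsat y \o g) v.
Proof.
move=> sg dy; have [_ [c dc sc]] := sg.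
have tr : smooth_near (coordsat y \o parat c) (coordsat c (g v)).
  apply: (@smooth_on_near _ _ _ (chart_image c (domat y))).
  - by apply: open_chart_image; exact: dom_open.
  - exact: chart_compatible.
  - exact: chart_imageT.
apply: eq_smooth_near (smooth_near_comp_mx sc tr).
have := smooth_germ_near sg (near_dom dc).
by apply: filterS => w dw; rewrite /= coordK.
Qed.

Lemma smooth_germ_nearby V n (N : manifold R n) (g : V -> N) v :
  smooth_germ g v -> \forall w \near v, smooth_germ g w.
Proof.
move=> sg; have [gc [c dc sc]] := sg.
have gcc : \forall w \near v, \forall z \near w, {for z, continuous g}.
  exact: near_join.
apply: filterS3 gcc (smooth_germ_near sg (near_dom dc)) (smooth_near_near sc).
by move=> w gw dw sw; split=> //; exists c.
Qed.

Lemma eq_smooth_germ V n (N : manifold R n) (g k : V -> N) v :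
  (\forall w \near v, g w = k w) -> smooth_germ g v -> smooth_germ k v.
Proof.
move=> gk sg; have [gc [c dc sc]] := sg.
have gkk : \forall w \near v, \forall z \near w, g z = k z by exact: near_join.
split.
  apply: filterS2 gkk gc => w gkw gcw.
  rewrite /prop_for /continuous_at -(nbhs_singleton gkw).
  exact: cvg_trans (near_eq_cvg gkw) gcw.
exists c; first by rewrite -(nbhs_singleton gk).
by apply: eq_smooth_near sc; apply: filterS gk => w /= ->.
Qed.

Lemma smooth_germ_comp V m n (N : manifold R n) (k : V -> 'rV[R]_m)
    (F : 'rV[R]_m -> N) v :
  smooth_near k v -> smooth_germ F (k v) -> smooth_germ (F \o k) v.
Proof.
move=> sk sF; have [_ [c dc sc]] := sF; split.
  have kc := smooth_near_continuous sk.
  apply: filterS2 (smooth_near_near sk) (kc _ (smooth_germ_nearby sF)) => w skw sFw.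
  by apply: continuous_comp; [exact: smooth_near_continuous|
    exact: smooth_germ_continuous].
exists c => //.
exact: (smooth_near_comp_mx sk sc).
Qed.

Lemma smooth_germ_pair_comp V m n (N : manifold R n) (s : V -> R)
    (k : V -> 'rV[R]_m) (F : R * 'rV[R]_m -> N) v :
  smooth_near s v -> smooth_near k v -> smooth_germ F (s v, k v) ->
  smooth_germ (fun w => F (s w, k w)) v.
Proof.
move=> ss sk sF; have [_ [c dc sc]] := sF.
have pc w : smooth_near s w -> smooth_near k w ->
    {for w, continuous (fun w => (s w, k w))}.
  move=> ssw skw; apply: differentiable_continuous.
  by apply: differentiable_pair; exact: smooth_near_diff.
split.
  apply: filterS3 (smooth_near_near ss) (smooth_near_near sk)
    (pc _ ss sk _ (smooth_germ_nearby sF)) => w ssw skw sFw.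
  apply: (@continuous_comp _ _ _ (fun w => (s w, k w)) F); first exact: pc.
  exact: smooth_germ_continuous.
exists c => //.
exact: (smooth_near_pair_comp_mx ss sk sc).
Qed.

Lemma smooth_into_germ V n (N : manifold R n) (W : set V) (g : V -> N) v :
  open W -> smooth_into W g -> W v -> smooth_germ g v.
Proof.
move=> oW [gc sg] Wv; split.
  by apply: (open_near oW) Wv => w Ww; exact: gc.
exists (g v); first exact: chart_at_dom.
have oWg : open (W `&` (g @^-1` (domat (g v)))).
  rewrite openE => w [Ww dw]; apply: filterI; first exact: open_nbhs_nbhs.
  exact: gc Ww _ (near_dom dw).
by apply: smooth_on_near oWg (sg _) _; split=> //; exact: chart_at_dom.
Qed.

Lemma smooth_map_germ m n (M : manifold R m) (N : manifold R n) (U : set M)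
    (f : M -> N) (c x : M) :
  open U -> smooth_map_on U f -> U x -> domat c x ->
  smooth_germ (f \o parat c) (coordsat c x).
Proof.
move=> oU /(_ c) sf Ux dx.
by apply: smooth_into_germ sf _; [exact: open_chart_image|exact: chart_imageT].
Qed.

Lemma smooth_fun_germ m (M : manifold R m) (W : normedModType R) (U : set M)
    (f : M -> W) (c x : M) :
  open U -> smooth_fun_on U f -> U x -> domat c x ->
  smooth_near (f \o parat c) (coordsat c x).
Proof.
move=> oU /(_ c) sf Ux dx.
by apply: smooth_on_near sf _; [exact: open_chart_image|exact: chart_imageT].
Qed.

Lemma smooth_family_germ m n (M : manifold R m) (N : manifold R n)
    (W : set (R * M)) (F : R -> M -> N) (s : R) (c x : M) :
  open W -> smooth_family_on W F -> W (s, x) -> domat c x ->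
  smooth_germ (fun p => F p.1 (parat c p.2)) (s, coordsat c x).
Proof.
move=> oW /(_ c) sF Wx dx; apply: smooth_into_germ sF _; last first.
  by split; [exact: chart_imageT|rewrite /= coordK].
rewrite openE => -[t _] /= [[z [dz _] <-]]; rewrite /= coordK // => Wz.
have nI : nbhs (coordsat c z) (chart_image c setT).
  by apply: open_nbhs_nbhs; split; [exact/open_chart_image/openT|
    exact: chart_imageT].
have nW : nbhs (t, coordsat c z) [set p : R * _ | W (p.1, parat c p.2)].
  have : (fun p : R * 'rV_m => (p.1, parat c p.2)) @ (t, coordsat c z) --> (t, z).
    apply: (@cvg_pair _ _ _ _ (nbhs t) (nbhs z)); first exact: cvg_fst.
    apply: (@cvg_comp _ _ _ snd (parat c)); last exact: par_cvg dz.
    exact: cvg_snd.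
  by move/(_ W); apply; apply: open_nbhs_nbhs.
have nI' : nbhs (t, coordsat c z) [set p : R * _ | chart_image c setT p.2].
  exact: (@cvg_snd _ _ (nbhs t) (nbhs (coordsat c z)) _ _ nI).
by apply: filterS2 nI' nW => -[].
Qed.

Lemma smooth_germ_par n (M : manifold R n) (c x : M) :
  domat c x -> smooth_germ (parat c) (coordsat c x).
Proof.
move=> dx; split.
  have : open (coordsat c @` domat c) by exact: image_open.
  move=> /open_near; apply; last by exists x.
  by move=> u; exact: par_continuous.
exists c; first by rewrite coordK.
apply: (@eq_smooth_near _ _ _ id).
  by apply: filterS (near_parK dx) => u /= [].
exact: smooth_near_id.
Qed.

Lemma smooth_germ_map V m n (M : manifold R m) (N : manifold R n)
    (g : V -> M) (f : M -> N) (c : M) v :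
  smooth_germ g v -> domat c (g v) ->
  smooth_germ (f \o parat c) (coordsat c (g v)) -> smooth_germ (f \o g) v.
Proof.
move=> sg dc sf.
apply: eq_smooth_germ (smooth_germ_comp (smooth_germ_coords sg dc) sf).
by apply: filterS (smooth_germ_near sg (near_dom dc)) => w dw; rewrite /= coordK.
Qed.

Lemma smooth_germ_family V m n (M : manifold R m) (N : manifold R n)
    (s : V -> R) (g : V -> M) (F : R -> M -> N) (c : M) v :
  smooth_near s v -> smooth_germ g v -> domat c (g v) ->
  smooth_germ (fun p => F p.1 (parat c p.2)) (s v, coordsat c (g v)) ->
  smooth_germ (fun w => F (s w) (g w)) v.
Proof.
move=> ss sg dc sF.
apply: eq_smooth_germ (smooth_germ_pair_comp ss (smooth_germ_coords sg dc) sF).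
by apply: filterS (smooth_germ_near sg (near_dom dc)) => w dw; rewrite /= coordK.
Qed.

End ManifoldCalculus.

(** * Differentials of maps and changes of chart *)

Section ManifoldDifferential.
Variable R : realType.
Implicit Types V : normedModType R.

(** Having a normed space as source treats curves, families and maps read in a chart alike;
    [tangent_map] and [velocity] are both instances. *)
Definition dmap V n (N : manifold R n) (g : V -> N) (v : V) : V -> 'rV[R]_n :=
  'd (coordsat (g v) \o g) v.

Lemma dmap_linear V n (N : manifold R n) (g : V -> N) v a u w :
  dmap g v (a *: u + w) = a *: dmap g v u + dmap g v w.
Proof. exact: linearP. Qed.

Lemma smooth_germ_diff V n (N : manifold R n) (g : V -> N) v y :
  smooth_germ g v -> domat y (g v) -> differentiable (coordsat y \o g) v.
Proof. by move=> sg dy; exact/smooth_near_diff/smooth_germ_coords. Qed.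

Lemma parat_base n (M : manifold R n) (x : M) : parat x (base x) = x.
Proof. by rewrite /base coordK //; exact: chart_at_dom. Qed.

(** The frame used by [dmap] at [v] changes with [g v], whereas the left side uses the fixed chart
    at [y] and can be differentiated further in [v]. *)
Lemma diff_chart V n (N : manifold R n) (g : V -> N) v y a :
  smooth_germ g v -> domat y (g v) ->
  'd (coordsat y \o g) v a = dcoord y (g v) (dmap g v a).
Proof.
move=> sg dy.
have dx := chart_at_dom (g v).
have sc : smooth_near (coordsat y \o parat (g v)) (coordsat (g v) (g v)).
  by apply: smooth_germ_coords; [exact: smooth_germ_par|rewrite coordK].
have E : \forall w \near v,
    ((coordsat y \o parat (g v)) \o (coordsat (g v) \o g)) w = (coordsat y \o g) w.
  by apply: filterS (smooth_germ_near sg (near_dom dx)) => w dw; rewrite /= coordK.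
have d1 := smooth_germ_diff sg dx.
have d2 : differentiable (coordsat y \o parat (g v)) ((coordsat (g v) \o g) v).
  exact: smooth_near_diff.
have [_ ->] := near_eq_diff E (differentiable_comp d1 d2).
by rewrite diff_comp.
Qed.

Lemma diff_fun V n (N : manifold R n) (W : normedModType R) (g : V -> N)
    (f : N -> W) v a :
  smooth_germ g v -> differentiable (f \o parat (g v)) (base (g v)) ->
  differentiable (f \o g) v /\ 'd (f \o g) v a = dfun f (g v) (dmap g v a).
Proof.
move=> sg df.
have dx := chart_at_dom (g v).
have E : \forall w \near v,
    ((f \o parat (g v)) \o (coordsat (g v) \o g)) w = (f \o g) w.
  by apply: filterS (smooth_germ_near sg (near_dom dx)) => w dw; rewrite /= coordK.
have d1 := smooth_germ_diff sg dx.
have [d2 E2] := near_eq_diff E (differentiable_comp d1 df).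
by split=> //; rewrite E2 diff_comp.
Qed.

Lemma dmap_map V m n (M : manifold R m) (N : manifold R n) (g : V -> M)
    (f : M -> N) v a :
  smooth_germ g v -> smooth_germ (f \o parat (g v)) (base (g v)) ->
  dmap (f \o g) v a = tangent_map f (g v) (dmap g v a).
Proof.
move=> sg sf.
have [|_] := @diff_fun _ _ _ _ g (coordsat (f (g v)) \o f) v a sg.
  apply: smooth_near_diff; apply: (smooth_germ_coords sf).
  by rewrite /= parat_base; exact: chart_at_dom.
by [].
Qed.

Lemma dmap_comp V V' n (N : manifold R n) (k : V -> V') (F : V' -> N) v a :
  differentiable k v -> smooth_germ F (k v) ->
  dmap (F \o k) v a = dmap F (k v) ('d k v a).
Proof.
move=> dk sF; rewrite /dmap (@diff_comp _ _ _ _ k (coordsat (F (k v)) \o F)) //.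
by apply: (smooth_germ_diff sF); exact: chart_at_dom.
Qed.

Lemma eq_dmap V n (N : manifold R n) (g k : V -> N) v :
  smooth_germ g v -> (\forall w \near v, g w = k w) -> dmap g v = dmap k v.
Proof.
move=> sg gk; rewrite /dmap (nbhs_singleton gk); apply/esym.
apply: (near_eq_diff _ _).2; first by apply: filterS gk => w /= ->.
apply: smooth_germ_diff sg _; rewrite (nbhs_singleton gk); exact: chart_at_dom.
Qed.

Lemma tangent_mapE m n (M : manifold R m) (N : manifold R n) (f : M -> N) x :
  tangent_map f x = dmap (f \o parat x) (base x).
Proof. by rewrite /dmap /= parat_base. Qed.

Lemma tangent_map_linear m n (M : manifold R m) (N : manifold R n) (f : M -> N)
  x a u w :
  tangent_map f x (a *: u + w) = a *: tangent_map f x u + tangent_map f x w.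
Proof. exact: linearP. Qed.

Lemma dcoord_linear n (M : manifold R n) (y x : M) a u w :
  dcoord y x (a *: u + w) = a *: dcoord y x u + dcoord y x w.
Proof. exact: linearP. Qed.

Lemma dpar_linear n (M : manifold R n) (y : M) c a u w :
  dpar y c (a *: u + w) = a *: dpar y c u + dpar y c w.
Proof. exact: linearP. Qed.

Lemma dfun_linear n (M : manifold R n) (W : normedModType R) (f : M -> W) x a u w :
  dfun f x (a *: u + w) = a *: dfun f x u + dfun f x w.
Proof. exact: linearP. Qed.

Lemma dparE n (M : manifold R n) (y : M) u : dpar y u = dmap (parat y) u.
Proof. by []. Qed.

Lemma diff_parK n (M : manifold R n) (y x : M) a : domat y x ->
  'd (coordsat y \o parat y) (coordsat y x) a = a.
Proof.
move=> dx; have id_d := @is_diff_id R 'rV[R]_n (coordsat y x).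
have [|_ ->] := @near_eq_diff _ _ _ id (coordsat y \o parat y) (coordsat y x) _
  (ex_diff (is_diff_def := id_d)).
  by apply: filterS (near_parK dx) => u /= [].
by rewrite diff_val.
Qed.

Lemma dcoordK n (M : manifold R n) (y x : M) b : domat y x ->
  dpar y (coordsat y x) (dcoord y x b) = b.
Proof.
move=> dx; have dxx := chart_at_dom x.
have spx : smooth_germ (parat x) (base x) by exact: smooth_germ_par.
have dyc : differentiable (coordsat y \o parat x) (base x).
  by apply: (smooth_germ_diff spx); rewrite parat_base.
have spy := smooth_germ_par dx.
rewrite dparE /dcoord /dfun.
have cE : (coordsat y \o parat x) (base x) = coordsat y x by rewrite /= parat_base.
rewrite -cE -(@dmap_comp _ _ _ _ (coordsat y \o parat x) (parat y)) //; last first.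
  by rewrite cE.
have E : \forall u \near base x,
    parat x u = (parat y \o (coordsat y \o parat x)) u.
  by apply: filterS (near_par dxx (near_dom dx)) => u du; rewrite /= coordK.
rewrite -(eq_dmap spx E) /dmap parat_base.
exact: diff_parK.
Qed.

Lemma dcoord_base n (M : manifold R n) (x : M) a : dcoord x x a = a.
Proof. by rewrite /dcoord /dfun /base diff_parK //; exact: chart_at_dom. Qed.

Lemma dpar_base n (M : manifold R n) (x : M) a : dpar x (base x) a = a.
Proof. by rewrite -[a in LHS](dcoord_base x) dcoordK //; exact: chart_at_dom. Qed.

Lemma dmap_family V m n (M : manifold R m) (N : manifold R n) (s : V -> R)
    (g : V -> M) (F : R -> M -> N) v a :
  smooth_near s v -> smooth_germ g v ->
  smooth_germ (fun p => F p.1 (parat (g v) p.2)) (s v, base (g v)) ->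
  dmap (fun w => F (s w) (g w)) v a =
  dmap (fun p => F p.1 (parat (g v) p.2)) (s v, base (g v))
    ('d s v a, dmap g v a).
Proof.
move=> ss sg sF.
have dx := chart_at_dom (g v).
have dc := smooth_germ_diff sg dx.
have ds := smooth_near_diff ss.
have dp : differentiable (fun w => (s w, coordsat (g v) (g w))) v.
  exact: (@differentiable_pair _ _ _ _ s (coordsat (g v) \o g)).
have sG : smooth_germ ((fun p => F p.1 (parat (g v) p.2)) \o
    (fun w => (s w, coordsat (g v) (g w)))) v.
  apply: (@smooth_germ_pair_comp _ _ _ _ _ s (coordsat (g v) \o g)) => //.
  exact: smooth_germ_coords.
rewrite -(@eq_dmap _ _ _ _ (fun w => F (s w) (g w)) _ sG); last first.
  by apply: filterS (smooth_germ_near sg (near_dom dx)) => w dw; rewrite /= coordK.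
rewrite dmap_comp //.
by rewrite (@diff_pair _ _ _ _ s (coordsat (g v) \o g)).
Qed.

(** The base point selects the chart in which vectors are written, so an equation such as
    [h (expR 0) x = x] is hard to rewrite term by term; as a hypothesis it is substituted everywhere
    at once. *)
Lemma dmap_map_at V m n (M : manifold R m) (N : manifold R n) (g : V -> M)
    (f : M -> N) v x a : g v = x ->
  smooth_germ g v -> smooth_germ (f \o parat x) (base x) ->
  dmap (f \o g) v a = tangent_map f x (dmap g v a).
Proof. by move=> <-; exact: dmap_map. Qed.

Lemma dmap_family_at V m n (M : manifold R m) (N : manifold R n) (s : V -> R)
    (g : V -> M) (F : R -> M -> N) v a t y : s v = t -> g v = y ->
  smooth_near s v -> smooth_germ g v ->
  smooth_germ (fun p => F p.1 (parat y p.2)) (t, base y) ->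
  dmap (fun w => F (s w) (g w)) v a =
  dmap (fun p => F p.1 (parat y p.2)) (t, base y) ('d s v a, dmap g v a).
Proof. by move=> <- <-; exact: dmap_family. Qed.

Lemma smooth_germ_cst V n (N : manifold R n) (y : N) (v : V) :
  smooth_germ (fun=> y) v.
Proof.
split; first by near=> w; exact: cst_continuous.
by exists y; [exact: chart_at_dom|exact: smooth_near_cst].
Unshelve. all: by end_near. Qed.

Lemma smooth_germ_map_continuous m n (M : manifold R m) (N : manifold R n)
    (f : M -> N) x :
  smooth_germ (f \o parat x) (base x) -> {for x, continuous f}.
Proof.
move=> sf; have dx := chart_at_dom x.
have E : \forall z \near x, f z = (f \o parat x \o coordsat x) z.
  by apply: filterS (near_dom dx) => z dz; rewrite /= coordK.
have c1 : {for x, continuous (f \o parat x \o coordsat x)}.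
  apply: continuous_comp; first exact: Defs.coord_continuous.
  exact: smooth_germ_continuous sf.
rewrite /prop_for /continuous_at [f x](nbhs_singleton E).
by apply: cvg_trans c1; apply: near_eq_cvg; apply: filterS E => z ->.
Qed.

Lemma dmap_cst V n (N : manifold R n) (y : N) (v a : V) : dmap (fun=> y) v a = 0.
Proof. by rewrite /dmap (diff_cst (coordsat y y)). Qed.

Lemma velocityE n (M : manifold R n) (g : R -> M) t :
  smooth_germ g t -> velocity g t = dmap g t 1.
Proof.
move=> sg; rewrite /velocity derive1E' //.
by apply: (smooth_germ_diff sg); exact: chart_at_dom.
Qed.

End ManifoldDifferential.

(** * Differentiation of forms *)

Section Forms.
Variable R : realType.
Implicit Types V : normedModType R.

Lemma scalarD n (l : 'rV[R]_n -> R) u w : scalar l -> l (u + w) = l u + l w.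
Proof. by move=> hl; have := hl 1 u w; rewrite scale1r mul1r. Qed.

Lemma scalar0 n (l : 'rV[R]_n -> R) : scalar l -> l 0 = 0.
Proof.
by move=> hl; have := hl (-1) 0 0; rewrite scaler0 addr0 mulN1r addNr.
Qed.

Lemma scalarZ n (l : 'rV[R]_n -> R) a u : scalar l -> l (a *: u) = a * l u.
Proof. by move=> hl; have := hl a u 0; rewrite addr0 (scalar0 hl) addr0. Qed.

Lemma scalarB n (l : 'rV[R]_n -> R) u w : scalar l -> l (u - w) = l u - l w.
Proof.
move=> hl; rewrite scalarD // -scaleN1r scalarZ //.
by rewrite mulN1r.
Qed.

Lemma scalar_expand n (l : 'rV[R]_n -> R) w : scalar l ->
  l w = \sum_(j < n) w 0 j * l (delta_mx 0 j).
Proof.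
move=> hl; rewrite {1}(row_sum_delta w).
elim/big_rec2: _ => [|j a b _ <-]; first exact: scalar0.
by rewrite scalarD // scalarZ.
Qed.

Lemma smooth_near_form V k (B : V -> 'rV[R]_k -> R) (w : V -> 'rV[R]_k) v :
  (forall y, scalar (B y)) -> (forall b, smooth_near (B ^~ b) v) ->
  smooth_near w v -> smooth_near (fun y => B y (w y)) v.
Proof.
move=> hB sB sw.
apply: (@eq_smooth_near _ _ _
   (fun y => \sum_(j < k) w y 0 j * B y (delta_mx 0 j))).
  by near=> y; rewrite -scalar_expand.
apply: smooth_near_sum => j; apply: smooth_nearM => //.
exact: smooth_near_coord.
Unshelve. all: by end_near. Qed.

Lemma differentiable_form V k (B : V -> 'rV[R]_k -> R) (w : V -> 'rV[R]_k) v :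
  (forall y, scalar (B y)) -> (forall b, differentiable (B ^~ b) v) ->
  differentiable w v -> differentiable (fun y => B y (w y)) v.
Proof.
move=> hB dB dw.
have -> : (fun y => B y (w y)) =
    \sum_(j < k) (fun y => w y 0 j * B y (delta_mx 0 j)).
  by apply/funext => y; rewrite fct_sumE -scalar_expand.
apply: differentiable_sum => j; apply: differentiableM; last exact: dB.
exact: differentiable_mx_coord.
Qed.

Lemma derive_form V k (B : V -> 'rV[R]_k -> R) (w : V -> 'rV[R]_k) v a :
  (forall y, scalar (B y)) -> (forall b, differentiable (B ^~ b) v) ->
  differentiable w v ->
  'D_a (fun y => B y (w y)) v = 'D_a (B ^~ (w v)) v + B v ('D_a w v).
Proof.
move=> hB dB dw.
have E (z : V -> 'rV[R]_k) : (fun y => B y (z y)) =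
    \sum_(j < k) (fun y => z y 0 j * B y (delta_mx 0 j)).
  by apply/funext => y; rewrite fct_sumE -scalar_expand.
rewrite !E derive_sum; last first.
  move=> j; apply: derivableM; apply: diff_derivable;
    [exact: differentiable_mx_coord|exact: dB].
rewrite derive_sum; last first.
  move=> j; apply: derivableM; apply: diff_derivable;
    [exact: differentiable_cst|exact: dB].
rewrite (scalar_expand _ (hB v)) -big_split; apply: eq_bigr => j _ /=.
have dBj := diff_derivable (v := a) (dB (delta_mx 0 j)).
rewrite (deriveM (diff_derivable (differentiable_mx_coord 0 j dw)) dBj).
rewrite (deriveM (diff_derivable (differentiable_cst _ _)) dBj).
rewrite derive_cst derive_mx_coord // scaler0 addr0.
by rewrite [_ *: 'D_a w v 0 j]mulrC.
Qed.

Lemma derive_comp V V' (W : normedModType R) (c : V -> V') (g : V' -> W) v a :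
  differentiable c v -> differentiable g (c v) ->
  'D_a (g \o c) v = 'D_('D_a c v) g (c v).
Proof.
move=> dc dg; rewrite [LHS]deriveE; last exact: differentiable_comp.
by rewrite (diff_comp dc dg) /= (deriveE _ dg) (deriveE _ dc).
Qed.

Lemma derive_eq V (W : normedModType R) (f g : V -> W) v a :
  (\forall y \near v, f y = g y) -> 'D_a f v = 'D_a g v.
Proof. exact: near_eq_derive. Qed.

Section TwoForm.
Variables (n : nat) (M : manifold R n) (omega : two_form M).
Hypothesis omega2 : is_two_form omega.

Lemma two_formP1 x w : scalar (omega x ^~ w).
Proof. by case: omega2. Qed.

Lemma two_formP2 x v : scalar (omega x v).
Proof. by case: omega2. Qed.

Lemma two_form_alt x v w : omega x v w = - omega x w v.
Proof.
have [_ _ /(_ x) alt _] := omega2.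
have := alt (v + w); rewrite (scalarD _ _ (two_formP1 x (v + w))).
rewrite !(scalarD _ _ (two_formP2 x _)) !alt add0r addr0 => /eqP.
by rewrite addr_eq0 => /eqP.
Qed.

Lemma two_form_localP1 y u w : scalar (two_form_local omega y u ^~ w).
Proof.
move=> a v v'; rewrite /two_form_local dpar_linear.
exact: (two_formP1 (parat y u) (dpar y u w) a).
Qed.

Lemma two_form_localP2 y u v : scalar (two_form_local omega y u v).
Proof.
move=> a w w'; rewrite /two_form_local dpar_linear.
exact: (two_formP2 (parat y u) (dpar y u v) a).
Qed.

Lemma two_form_local_smooth (y x : M) a b : domat y x ->
  smooth_near (fun u => two_form_local omega y u a b) (coordsat y x).
Proof.
move=> dx; have [_ _ _ /(_ y a b) sm] := omega2.
apply: smooth_on_near sm _; first exact/open_chart_image/openT.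
exact: chart_imageT.
Qed.

Lemma two_form_local_smooth_along V (y x : M) (c v w : V -> 'rV[R]_n) (t : V) :
  domat y x -> c t = coordsat y x ->
  smooth_near c t -> smooth_near v t -> smooth_near w t ->
  smooth_near (fun s => two_form_local omega y (c s) (v s) (w s)) t.
Proof.
move=> dx ct sc sv sw.
apply: (@smooth_near_form _ _ (fun s => two_form_local omega y (c s) (v s))) => //.
  by move=> s; exact: two_form_localP2.
move=> b.
apply: (@smooth_near_form _ _ (fun s a => two_form_local omega y (c s) a b)) => //.
  by move=> s; exact: two_form_localP1.
move=> a.
apply: (@smooth_near_comp _ _ _ c (fun u => two_form_local omega y u a b)) => //.
by rewrite ct; exact: two_form_local_smooth.
Qed.

(** Along a curve [c] this yields Lie derivatives; with [c] the identity it yields the derivatives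
    of the contraction of [omega] with a field. *)
Lemma derive_two_form V (y x : M) (c v w : V -> 'rV[R]_n) (t a : V) :
  domat y x -> c t = coordsat y x ->
  smooth_near c t -> smooth_near v t -> smooth_near w t ->
  'D_a (fun s => two_form_local omega y (c s) (v s) (w s)) t =
    'D_('D_a c t) (fun u => two_form_local omega y u (v t) (w t)) (c t)
    + two_form_local omega y (c t) ('D_a v t) (w t)
    + two_form_local omega y (c t) (v t) ('D_a w t).
Proof.
move=> dx ct sc sv sw.
have dB b : differentiable (fun s => two_form_local omega y (c s) (v s) b) t.
  apply/smooth_near_diff/(two_form_local_smooth_along dx ct) => //.
  exact: smooth_near_cst.
have E1 := @derive_form _ _ (fun s => two_form_local omega y (c s) (v s)) w t a
  (fun s => two_form_localP2 y (c s) (v s)) dB (smooth_near_diff sw).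
have dB' b : differentiable (fun s => two_form_local omega y (c s) b (w t)) t.
  apply/smooth_near_diff/(two_form_local_smooth_along dx ct) => //;
    exact: smooth_near_cst.
have E2 := @derive_form _ _ (fun s b => two_form_local omega y (c s) b (w t)) v t a
  (fun s => two_form_localP1 y (c s) (w t)) dB' (smooth_near_diff sv).
have dO : differentiable (fun u => two_form_local omega y u (v t) (w t)) (c t).
  by apply: smooth_near_diff; rewrite ct; exact: two_form_local_smooth.
have E3 := @derive_comp _ _ _ c _ t a (smooth_near_diff sc) dO.
apply: etrans E1 _; apply: (congr1 (fun z => z + _)).
by apply: etrans E2 _; apply: (congr1 (fun z => z + _)).
Qed.

End TwoForm.

End Forms.

(** * One-parameter families of maps *)

Section Families.
Variable R : realType.
Implicit Types V : normedModType R.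

Lemma is_diff_pair_fst V V' (w : V') (v : V) :
  is_diff v (fun t : V => (t, w)) (fun a : V => (a, 0 : V')).
Proof. exact: is_diff_pair. Qed.

Lemma is_diff_pair_snd V V' (w : V') (v : V) :
  is_diff v (fun t : V => (w, t)) (fun a : V => (0 : V', a)).
Proof. exact: is_diff_pair. Qed.

Lemma smooth_near_pair1 p q n (k : R * 'rV[R]_n -> 'M[R]_(p, q)) (t : R) u :
  smooth_near k (t, u) -> smooth_near (fun s => k (s, u)) t.
Proof.
move=> sk; apply: (@smooth_near_pair_comp_mx _ _ _ _ _ id (fun=> u) k) => //.
  exact: smooth_near_id.
exact: smooth_near_cst.
Qed.

Lemma smooth_near_pair2 p q n (k : R * 'rV[R]_n -> 'M[R]_(p, q)) (t : R) u :
  smooth_near k (t, u) -> smooth_near (fun w => k (t, w)) u.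
Proof.
move=> sk; apply: (@smooth_near_pair_comp_mx _ _ _ _ _ (fun=> t) id k) => //.
  exact: smooth_near_cst.
exact: smooth_near_id.
Qed.

Lemma derive_pair1 V n (k : R * 'rV[R]_n -> V) (t a : R) u :
  differentiable k (t, u) ->
  'D_a (fun s => k (s, u)) t = 'D_((a, 0) : R * 'rV[R]_n) k (t, u).
Proof.
move=> dk; have d1 := is_diff_pair_fst u t.
have := derive_comp a (@ex_diff _ _ _ _ _ _ _ d1) dk.
by rewrite (deriveE a (@ex_diff _ _ _ _ _ _ _ d1)) (@diff_val _ _ _ _ _ _ _ d1).
Qed.

Lemma derive_pair2 V n (k : R * 'rV[R]_n -> V) (t : R) u a :
  differentiable k (t, u) ->
  'D_a (fun w => k (t, w)) u = 'D_((0, a) : R * 'rV[R]_n) k (t, u).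
Proof.
move=> dk; have d1 := is_diff_pair_snd t u.
have := derive_comp a (@ex_diff _ _ _ _ _ _ _ d1) dk.
by rewrite (deriveE a (@ex_diff _ _ _ _ _ _ _ d1)) (@diff_val _ _ _ _ _ _ _ d1).
Qed.

Lemma near_pair1 n (Q : R * 'rV[R]_n -> Prop) (t : R) (u : 'rV[R]_n) :
  (\forall p \near (t, u), Q p) -> \forall s \near t, Q (s, u).
Proof.
move=> HQ; have d1 := is_diff_pair_fst u t.
exact: (differentiable_continuous (@ex_diff _ _ _ _ _ _ _ d1)) _ HQ.
Qed.

Lemma near_pair2 n (Q : R * 'rV[R]_n -> Prop) (t : R) (u : 'rV[R]_n) :
  (\forall p \near (t, u), Q p) -> \forall w \near u, Q (t, w).
Proof.
move=> HQ; have d1 := is_diff_pair_snd t u.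
exact: (differentiable_continuous (@ex_diff _ _ _ _ _ _ _ d1)) _ HQ.
Qed.

Section Family.
Variables (n : nat) (M : manifold R n) (F : R -> M -> M).

Definition family_in_chart (c : M) (q : R * 'rV[R]_n) : 'rV[R]_n :=
  coordsat c (F q.1 (parat c q.2)).

(** No group law is asked: only first-order behaviour at time 0 enters, and both the Euler flow and
    the lift of a contact flow qualify. *)
Definition smooth_family_at (c x : M) : Prop :=
  smooth_germ (fun q => F q.1 (parat c q.2)) (0 : R, coordsat c x) /\
  \forall z \near x, F 0 z = z.

Definition initial_velocity : vector_field M := fun x => velocity (F ^~ x) 0.

Lemma family_in_chart_smooth c x t :
  smooth_germ (fun q => F q.1 (parat c q.2)) (t, coordsat c x) -> domat c x ->
  domat c (F t x) -> smooth_near (family_in_chart c) (t, coordsat c x).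
Proof.
by move=> sF dx dFx; apply: (smooth_germ_coords sF); rewrite /= coordK.
Qed.

Lemma family_in_chart_smooth0 c x : smooth_family_at c x -> domat c x ->
  smooth_near (family_in_chart c) (0, coordsat c x).
Proof.
move=> [sF /nbhs_singleton F0] dx.
by apply: family_in_chart_smooth => //; rewrite F0.
Qed.

Lemma smooth_family_at_near c x : smooth_family_at c x -> domat c x ->
  \forall u \near coordsat c x, smooth_family_at c (parat c u).
Proof.
move=> [sF F0] dx.
apply: filterS3 (near_pair2 (smooth_germ_nearby sF)) (near_parK dx)
  (near_par dx (near_join F0)) => u sFu [du cu] F0u.
by split=> //; rewrite cu.
Qed.

Lemma family_curve_germ c x t : domat c x ->
  smooth_germ (fun q => F q.1 (parat c q.2)) (t, coordsat c x) ->
  smooth_germ (F ^~ x) t.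
Proof.
move=> dx sF.
have -> : F ^~ x =
    (fun t => (fun q : R * 'rV_n => F q.1 (parat c q.2)) (id t, (fun=> coordsat c x) t)).
  by apply/funext => s /=; rewrite coordK.
apply: (@smooth_germ_pair_comp _ _ _ _ _ id (fun=> coordsat c x)
  (fun q => F q.1 (parat c q.2))) => //.
  exact: smooth_near_id.
exact: smooth_near_cst.
Qed.

Lemma family_map_germ c u t :
  smooth_germ (fun q => F q.1 (parat c q.2)) (t, u) ->
  smooth_germ (F t \o parat c) u.
Proof.
move=> sF; apply: (@smooth_germ_pair_comp _ _ _ _ _ (fun=> t) id
  (fun q => F q.1 (parat c q.2))) => //.
  exact: smooth_near_cst.
exact: smooth_near_id.
Qed.

Lemma vf_local_initial_velocity c x : smooth_family_at c x -> domat c x ->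
  vf_local initial_velocity c (coordsat c x) =
  'D_(1, 0) (family_in_chart c) (0, coordsat c x).
Proof.
move=> sFx dx; have [sF /nbhs_singleton F0] := sFx.
rewrite /vf_local coordK //.
have sFx' : smooth_germ (F ^~ x) 0 := family_curve_germ dx sF.
rewrite /initial_velocity velocityE //.
have dFx : domat c (F 0 x) by rewrite F0.
have := diff_chart (1 : R) sFx' dFx; rewrite F0 => <-.
rewrite -(deriveE _ (smooth_germ_diff sFx' dFx)).
have -> : coordsat c \o F ^~ x = (fun t => family_in_chart c (t, coordsat c x)).
  by apply/funext => t; rewrite /family_in_chart /= coordK.
apply: derive_pair1; apply: smooth_near_diff.
exact: family_in_chart_smooth0.
Qed.

Lemma near_vf_local_initial_velocity c x : smooth_family_at c x -> domat c x ->
  \forall u \near coordsat c x,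
    'D_(1, 0) (family_in_chart c) (0, u) = vf_local initial_velocity c u.
Proof.
move=> sFx dx.
apply: filterS2 (smooth_family_at_near sFx dx) (near_parK dx) => u sFu [du cu].
by have := vf_local_initial_velocity sFu du; rewrite cu.
Qed.

Lemma initial_velocity_smooth c x : smooth_family_at c x -> domat c x ->
  smooth_near (vf_local initial_velocity c) (coordsat c x).
Proof.
move=> sFx dx; apply: eq_smooth_near (near_vf_local_initial_velocity sFx dx) _.
apply: (@smooth_near_pair2 _ _ _ ('D_(1, 0) (family_in_chart c)) 0).
exact/smooth_near_derive/family_in_chart_smooth0.
Qed.

(** * First-order behaviour of a family in the chart at its base point *)

Section AtPoint.
Variable x : M.
Hypothesis sFx : smooth_family_at x x.

Let dx : domat x x := chart_at_dom x.
Let sF : smooth_near (family_in_chart x) (0, base x) :=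
  family_in_chart_smooth0 sFx dx.

Lemma vf_local_base (X : vector_field M) : vf_local X x (base x) = X x.
Proof. by rewrite /vf_local parat_base dcoord_base. Qed.

Lemma family_in_chart0 u : F 0 (parat x u) = parat x u ->
  coordsat x (parat x u) = u -> family_in_chart x (0, u) = u.
Proof. by rewrite /family_in_chart /= => ->. Qed.

Lemma family_base : family_in_chart x (0, base x) = base x.
Proof.
have [_ /nbhs_singleton F0] := sFx.
by rewrite /family_in_chart /= parat_base F0.
Qed.

Lemma derive_family_base :
  'D_1 (fun t => family_in_chart x (t, base x)) 0 = initial_velocity x.
Proof.
rewrite derive_pair1; last exact: smooth_near_diff.
by rewrite -vf_local_initial_velocity // vf_local_base.
Qed.

Lemma family_diff0 a : 'D_((0, a) : R * 'rV[R]_n) (family_in_chart x) (0, base x) = a.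
Proof.
rewrite -derive_pair2; last exact: smooth_near_diff.
have [_ F0] := sFx.
have /derive_eq -> : \forall u \near base x, family_in_chart x (0, u) = id u.
  apply: filterS2 (near_parK dx) (near_par dx F0) => u [_ cu] F0u.
  exact: family_in_chart0.
by rewrite derive_id.
Qed.

(* The derivatives of the family in [t] and in the direction [a] commute. *)
Lemma derive_family_diff a :
  'D_1 (fun t => 'D_((0, a) : R * 'rV[R]_n) (family_in_chart x) (t, base x)) 0 =
  'D_a (vf_local initial_velocity x) (base x).
Proof.
have sD b := smooth_near_diff (smooth_near_derive b sF).
apply: etrans (derive_pair1 1 (sD _)) _.
apply: etrans (smooth_near_derive_comm_mx _ _ sF) _.
apply: etrans (esym (derive_pair2 a (sD _))) _.
exact: (derive_eq _ (near_vf_local_initial_velocity sFx dx)).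
Qed.

(** Properties of a family such as homogeneity are stated with [tangent_map (F t) x], written in the
    chart at [F t x]. This turns them into statements in the fixed chart at [x], where they can be
    differentiated in [t]. *)
Lemma near_family_diff a : \forall t \near (0 : R),
  domat x (F t x) /\ family_in_chart x (t, base x) = coordsat x (F t x) /\
  dpar x (family_in_chart x (t, base x))
    ('D_((0, a) : R * 'rV[R]_n) (family_in_chart x) (t, base x)) =
  tangent_map (F t) x a.
Proof.
have [sFg /nbhs_singleton F0] := sFx.
have dF : \forall t \near (0 : R), domat x (F t x).
  have : domat x (F 0 (parat x (base x))) by rewrite parat_base F0.
  move=> d0; have := near_pair1 (smooth_germ_near sFg (near_dom d0)).
  by apply: filterS => t /=; rewrite parat_base.
apply: filterS2 dF (near_pair1 (smooth_germ_nearby sFg)) => t dFt sFt.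
have E1 : family_in_chart x (t, base x) = coordsat x (F t x).
  by rewrite /family_in_chart /= parat_base.
split=> //; split=> //; rewrite E1.
have sFt2 : smooth_germ (F t \o parat x) (base x) := family_map_germ sFt.
have dFt2 : domat x ((F t \o parat x) (base x)) by rewrite /= parat_base.
rewrite -derive_pair2; last exact/smooth_near_diff/family_in_chart_smooth.
have := diff_chart a sFt2 dFt2; rewrite -(deriveE _ (smooth_germ_diff sFt2 dFt2)).
move=> /= ->; rewrite parat_base tangent_mapE dcoordK //.
Qed.

End AtPoint.

End Family.

End Families.

(** * The Liouville form *)

Section Bundle.
Variable R : realType.

Variables (p m : nat) (P : manifold R p) (M : manifold R m).
Variables (tau : P -> M) (h : R -> P -> P) (omega : two_form P).
Hypothesis bundleP : presymplectic_Rx_bundle tau h omega.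

Notation E := (euler_vf h).
Notation theta := (liouville_form h omega).

Let omega2 : is_two_form omega.
Proof. by case: bundleP => _ []. Qed.

Lemma open_nonzero_first : open [set q : R * P | q.1 != 0].
Proof.
rewrite openE => -[s x] /= s0.
have : nbhs (s, x) (fst @^-1` [set t : R | t != 0]).
  by apply: (@cvg_fst _ _ (nbhs s) (nbhs x)); apply: open_nbhs_nbhs; split=> //;
    exact: open_neq.
by [].
Qed.

Lemma action_germ (s : R) x c : s != 0 -> domat c x ->
  smooth_germ (fun q => h q.1 (parat c q.2)) (s, coordsat c x).
Proof.
move=> s0 dx; have [[_ sh _ _ _] _ _ _] := bundleP.
exact: (smooth_family_germ open_nonzero_first sh).
Qed.

Lemma action_fixed_germ (s : R) x c : s != 0 -> domat c x ->
  smooth_germ (h s \o parat c) (coordsat c x).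
Proof.
move=> s0 dx.
exact/family_map_germ/action_germ.
Qed.

Lemma tau_germ x c : domat c x -> smooth_germ (tau \o parat c) (coordsat c x).
Proof.
move=> dx; have [[st _ _ _ _] _ _ _] := bundleP.
exact: (smooth_map_germ openT st).
Qed.

Lemma action1 x : h 1 x = x.
Proof. by have [[_ _ [h1 _] _ _] _ _ _] := bundleP. Qed.

Lemma actionM (s t : R) x : s != 0 -> t != 0 -> h s (h t x) = h (s * t) x.
Proof. by have [[_ _ [_ hM] _ _] _ _ _] := bundleP; exact: hM. Qed.

Lemma tau_action (s : R) x : s != 0 -> tau (h s x) = tau x.
Proof. by have [[_ _ _ th _] _ _ _] := bundleP; exact: th. Qed.

Lemma actionK (s : R) x : s != 0 -> h s^-1 (h s x) = x.
Proof. by move=> s0; rewrite actionM ?invr_eq0 // mulVf // action1. Qed.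

Definition euler_flow (t : R) (x : P) : P := h (expR t) x.

Lemma euler_flow_germ t c x : domat c x ->
  smooth_germ (fun q => euler_flow q.1 (parat c q.2)) (t, coordsat c x).
Proof.
move=> dx.
apply: (@smooth_germ_pair_comp _ _ _ _ _ (@expR R \o fst) snd
  (fun q => h q.1 (parat c q.2))).
- by apply: smooth_near_lin; [exact: is_diff_fst|exact: smooth_near_expR].
- by apply: smooth_near_linear; exact: is_diff_snd.
- by apply: action_germ => //=; rewrite gt_eqF // expR_gt0.
Qed.

Lemma euler_flow_at c x : domat c x -> smooth_family_at euler_flow c x.
Proof.
move=> dx; split; first exact: euler_flow_germ.
by near=> z; rewrite /euler_flow expR0 action1.
Unshelve. all: by end_near. Qed.

Lemma orbit_germ x t : smooth_germ (fun s => h (expR s) x) t.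
Proof.
exact: (family_curve_germ (chart_at_dom x) (euler_flow_germ t (chart_at_dom x))).
Qed.

Lemma orbit0 x : h (expR 0) x = x.
Proof. by rewrite expR0 action1. Qed.

Lemma eulerE x : E x = dmap (fun s => h (expR s) x) 0 1.
Proof. by rewrite /euler_vf velocityE //; exact: orbit_germ. Qed.

Lemma euler_smooth c x : domat c x -> smooth_near (vf_local E c) (coordsat c x).
Proof. by move=> dx; exact: (initial_velocity_smooth (euler_flow_at dx) dx). Qed.

(** The group is commutative, so [h s] carries the orbit curve of [x] to that of [h s x] with the
    same parameter. *)
Lemma euler_action (s : R) x : s != 0 -> tangent_map (h s) x (E x) = E (h s x).
Proof.
move=> s0; rewrite (eulerE x) (eulerE (h s x)).
rewrite -(dmap_map_at _ (orbit0 x)); last first.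
- by apply: action_fixed_germ => //; exact: chart_at_dom.
- exact: orbit_germ.
rewrite (_ : h s \o _ = fun t => h (expR t) (h s x)) //.
apply/funext => t /=.
have e0 : expR t != 0 by rewrite gt_eqF // expR_gt0.
by rewrite !actionM // mulrC.
Qed.

Lemma tau_euler x : tangent_map tau x (E x) = 0.
Proof.
rewrite eulerE -(dmap_map_at _ (orbit0 x)); last first.
- by apply: tau_germ; exact: chart_at_dom.
- exact: orbit_germ.
rewrite (_ : tau \o _ = (fun=> tau x)); first exact: dmap_cst.
by apply/funext => t /=; rewrite tau_action // gt_eqF // expR_gt0.
Qed.

Lemma tau_tangent_action (s : R) x v : s != 0 ->
  tangent_map tau (h s x) (tangent_map (h s) x v) = tangent_map tau x v.
Proof.
move=> s0; have dx := chart_at_dom x.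
rewrite (tangent_mapE (h s) x) (tangent_mapE tau x).
have E1 : (h s \o parat x) (base x) = h s x by rewrite /= parat_base.
rewrite -(dmap_map_at _ E1); last first.
- by apply: tau_germ; exact: chart_at_dom.
- exact: action_fixed_germ.
rewrite (_ : tau \o _ = tau \o parat x) //.
by apply/funext => u /=; rewrite tau_action.
Qed.

Lemma tangent_actionK (s : R) x v : s != 0 ->
  tangent_map (h s^-1) (h s x) (tangent_map (h s) x v) = v.
Proof.
move=> s0; have dx := chart_at_dom x.
rewrite (tangent_mapE (h s) x).
have E1 : (h s \o parat x) (base x) = h s x by rewrite /= parat_base.
rewrite -(dmap_map_at _ E1); last first.
- by apply: action_fixed_germ; [rewrite invr_eq0|exact: chart_at_dom].
- exact: action_fixed_germ.
rewrite (_ : h s^-1 \o (h s \o parat x) = parat x); last by apply/funext => u /=; rewrite actionK.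
by rewrite -dparE dpar_base.
Qed.

Lemma tangent_actionVK (s : R) x w : s != 0 ->
  tangent_map (h s) x (tangent_map (h s^-1) (h s x) w) = w.
Proof.
move=> s0; have sV0 : s^-1 != 0 by rewrite invr_eq0.
by have := tangent_actionK (h s x) w sV0; rewrite invrK actionK.
Qed.

Lemma theta_scalar x : scalar (theta x).
Proof. exact: two_formP2. Qed.

Lemma omega_action (s : R) x v w : s != 0 ->
  omega (h s x) (tangent_map (h s) x v) (tangent_map (h s) x w) = s * omega x v w.
Proof. by have [_ _ oh _] := bundleP; exact: oh. Qed.

Lemma theta_action (s : R) x v : s != 0 ->
  theta (h s x) (tangent_map (h s) x v) = s * theta x v.
Proof.
by move=> s0; rewrite /liouville_form /contract2 -euler_action // omega_action.
Qed.

Lemma theta_euler x : theta x (E x) = 0.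
Proof. by have [_ _ alt _] := omega2; exact: alt. Qed.

(** * Local triviality and vertical vectors *)

Lemma nbhs_trivialization x : exists (U : set M) (sigma : M -> P) (u : P -> R),
  [/\ open U, U (tau x), smooth_map_on U sigma, smooth_fun_on (tau @^-1` U) u &
   [/\ open (tau @^-1` U), (forall y, U y -> tau (sigma y) = y),
     (forall y s, U y -> s != 0 -> u (h s (sigma y)) = s) &
     forall x, U (tau x) -> u x != 0 /\ h (u x) (sigma (tau x)) = x]].
Proof.
have [[_ _ _ _ /(_ (tau x)) triv] _ _ _] := bundleP.
have [U [sigma [u [[oU Ux] [ss su] ts us hs]]]] := triv.
have ot : open (tau @^-1` U).
  rewrite openE => z Uz.
  have tc := smooth_germ_map_continuous (tau_germ (chart_at_dom z)).
  by apply: tc; exact: open_nbhs_nbhs.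
exists U, sigma, u.
exact: (And5 oU Ux ss su (And4 ot ts us hs)).
Qed.

(** Euler's identity, obtained by differentiating the scaling law at [t = 0]. It serves both for
    Hamiltonians and for the fibre coordinate of a trivialization. *)
Lemma dfun_euler (f : P -> R) x : differentiable (f \o parat x) (base x) ->
  (forall t, f (h (expR t) x) = expR t * f x) -> dfun f x (E x) = f x.
Proof.
move=> df fh; have sx := orbit_germ x 0.
have df' : differentiable (f \o parat (h (expR 0) x)) (base (h (expR 0) x)).
  by rewrite orbit0.
have [_] := diff_fun (1 : R) sx df'.
rewrite orbit0 -eulerE => <-.
have de : differentiable (@expR R) 0 by exact/smooth_near_diff/smooth_near_expR.
have dv := is_derive_expRM (f x).
rewrite (_ : f \o _ = (fun t : R => expR t * f x)); last exact/funext.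
rewrite -deriveE ?derive_val //.
exact/derivable1_diffP/(@ex_derive _ _ _ _ _ _ _ dv).
Qed.

(** The fibre coordinate [u] of a trivialization is nonzero and scales along the orbit, so its
    derivative along [E] is [u x], which is not zero. *)
Lemma euler_neq0 x : E x != 0.
Proof.
have [U [sigma [u [oU Ux _ su [otU _ us hs]]]]] := nbhs_trivialization x.
have [ux0 hx] := hs x Ux.
have : dfun u x (E x) = u x.
  apply: dfun_euler => [|t].
    apply: smooth_near_diff.
    by apply: (smooth_fun_germ otU su) => //; exact: chart_at_dom.
  have e0 : expR t != 0 by rewrite gt_eqF // expR_gt0.
  by rewrite -{1}hx actionM // us // mulf_neq0.
by apply: contra_eq_neq => ->; rewrite /dfun linear0 eq_sym.
Qed.

(** Near [x] the identity is [z |-> h (u z) (sigma (tau z))]. On a vertical vector [sigma \o tau]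
    has zero derivative; what remains is the variation of [u], which moves the point along its
    fibre, hence along [E]. *)
Lemma vertical_euler x v : tangent_map tau x v = 0 -> exists c, v = c *: E x.
Proof.
move=> tv.
have [U [sigma [u [oU Ux ss su [otU ts us hs]]]]] := nbhs_trivialization x.
have dx := chart_at_dom x.
have [ux0 hx] := hs x Ux.
set y := sigma (tau x).
have sG : smooth_germ (fun q => h q.1 (parat y q.2)) (u x, base y).
  by apply: action_germ => //; exact: chart_at_dom.
(* The differential of the action at [(u x, y)], a pair sent to [x]; [G (1, 0)] is the direction of
   the fibre at [x]. *)
pose G := dmap (fun q => h q.1 (parat y q.2)) (u x, base y).
have Glin c : G (c, 0) = c *: G (1, 0).
  have := dmap_linear (fun q => h q.1 (parat y q.2)) (u x, base y) c (1, 0) 0.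
  rewrite -/G addr0 (_ : G 0 = 0) ?addr0 => [<-|]; last first.
    by rewrite /G /dmap linear0.
  by congr G; congr pair; rewrite /= ?scaler0 //; exact/esym/mulr1.
(* The orbit of [x] is run from [y] instead, with group parameter [expR s * u x], whose derivative
   at 0 is [u x]. *)
have EG : E x = u x *: G (1, 0).
  rewrite -Glin eulerE.
  have -> : (fun s => h (expR s) x) = (fun s => h (expR s * u x) ((fun=> y) s)).
    apply/funext => s; rewrite -actionM // ?hx //.
    by rewrite gt_eqF // expR_gt0.
  have dv := is_derive_expRM (u x).
  have se : smooth_near (fun t : R => expR t * u x) 0.
    by apply: smooth_nearM; [exact: smooth_near_expR|exact: smooth_near_cst].
  rewrite (@dmap_family_at _ _ _ _ _ _ _ _ _ _ _ (u x) y) //.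
  - rewrite dmap_cst -deriveE ?derive_val //; exact: smooth_near_diff.
  - by rewrite expR0 mul1r.
  - exact: smooth_germ_cst.
pose g := sigma \o (tau \o parat x).
have st : smooth_germ (tau \o parat x) (base x) by exact: tau_germ.
have ssx : smooth_germ (sigma \o parat (tau x)) (base (tau x)).
  by apply: (smooth_map_germ oU ss) => //; exact: chart_at_dom.
have tx : (tau \o parat x) (base x) = tau x by rewrite /= parat_base.
have sg : smooth_germ g (base x).
  apply: (smooth_germ_map (c := tau x) st); rewrite tx //; exact: chart_at_dom.
have gy : g (base x) = y by rewrite /g /= parat_base.
have gv : dmap g (base x) v = 0.
  by rewrite (dmap_map_at _ tx) // -tangent_mapE tv /tangent_map linear0.
have sux : smooth_near (u \o parat x) (base x).
  exact: (smooth_fun_germ otU su).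
have near_triv : \forall w \near base x, parat x w = h ((u \o parat x) w) (g w).
  have nU : \forall z \near x, U (tau z).
    exact: (open_nbhs_nbhs (conj otU Ux)).
  apply: filterS (near_par dx nU) => w Uw; exact/esym/(hs _ Uw).2.
have vE : v = G ('d (u \o parat x) (base x) v, 0).
  rewrite -[LHS](dpar_base x) dparE (eq_dmap (smooth_germ_par dx) near_triv).
  rewrite (@dmap_family_at _ _ _ _ _ _ _ _ _ _ _ (u x) y) //.
  - by rewrite gv.
  - by rewrite /= parat_base.
exists ('d (u \o parat x) (base x) v / u x).
by rewrite {1}vE Glin EG scalerA divfK.
Qed.

(** Otherwise [E x] would be a nonzero vertical vector in [chi omega]. *)
Lemma theta_neq0 x : exists w, theta x w != 0.
Proof.
apply/not_existsP => th0; have /negP := euler_neq0 x; apply.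
have [_ _ _ /(_ x (E x)) chiE] := bundleP.
apply/eqP/chiE; last exact: tau_euler.
by move=> w; apply/eqP/negPn/negP; exact: th0.
Qed.

(** * Exterior and Lie derivatives of the Liouville form *)

Lemma theta_local_scalar c u : scalar (one_form_local theta c u).
Proof.
move=> a b b'; rewrite /one_form_local dpar_linear.
exact: (theta_scalar (parat c u) a).
Qed.

Lemma near_theta_local c x b : domat c x -> \forall u \near coordsat c x,
  two_form_local omega c u (vf_local E c u) b = one_form_local theta c u b.
Proof.
move=> dx; apply: filterS (near_parK dx) => u [du cu].
rewrite /two_form_local /one_form_local /liouville_form /contract2 /vf_local.
by rewrite -{2}cu dcoordK.
Qed.

Lemma theta_local_smooth c x b : domat c x ->
  smooth_near (fun u => one_form_local theta c u b) (coordsat c x).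
Proof.
move=> dx; apply: eq_smooth_near (near_theta_local b dx) _.
apply: (two_form_local_smooth_along omega2 dx) => //.
- exact: smooth_near_id.
- exact: euler_smooth.
- exact: smooth_near_cst.
Qed.

Lemma one_form_local_base (al : one_form P) x b : one_form_local al x (base x) b = al x b.
Proof. by rewrite /one_form_local dpar_base parat_base. Qed.

Lemma two_form_local_base x a b : two_form_local omega x (base x) a b = omega x a b.
Proof. by rewrite /two_form_local !dpar_base parat_base. Qed.

(* [L_E omega = omega], the infinitesimal form of [h_s^* omega = s omega] *)
Lemma lie_euler_omega x a b :
  'D_(E x) (fun u => two_form_local omega x u a b) (base x)
  + omega x ('D_a (vf_local E x) (base x)) b
  + omega x a ('D_b (vf_local E x) (base x)) = omega x a b.
Proof.
have dx := chart_at_dom x; have fE := euler_flow_at dx.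
pose Psi := family_in_chart euler_flow x.
have sPsi : smooth_near Psi (0, base x) by exact: family_in_chart_smooth0.
(* The image of [a] under the Euler flow at time [t], in the fixed chart at [x]. *)
pose v a t := 'D_((0, a) : R * 'rV[R]_p) Psi (t, base x).
have sv c : smooth_near (v c) 0.
  by apply: (@smooth_near_pair1 _ _ _ _ ('D_(0, c) Psi)); exact: smooth_near_derive.
(* Homogeneity of [omega] along the flow. The product rule differentiates the left side at [t = 0]
   into the three terms of the claim, and the right side gives [omega x a b]. *)
have hom : \forall t \near (0 : R),
    two_form_local omega x (Psi (t, base x)) (v a t) (v b t) = expR t * omega x a b.
  apply: filterS2 (near_family_diff fE a) (near_family_diff fE b).
  move=> t [dt [Et Ea]] [_ [_ Eb]].
  rewrite /two_form_local Ea Eb /Psi Et coordK // omega_action //.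
  by rewrite gt_eqF // expR_gt0.
have D := derive_eq (1 : R) hom.
have := derive_two_form omega2 (1 : R) dx (family_base fE)
  (smooth_near_pair1 sPsi) (sv a) (sv b).
move=> D2; have := etrans (esym D2) D.
have v0 c : v c 0 = c by exact: family_diff0.
have c0 : Psi (0, base x) = base x by exact: family_base.
rewrite !v0 c0.
have Dv c : 'D_1 (v c) 0 = 'D_c (vf_local E x) (base x).
  exact: derive_family_diff.
rewrite (Dv a) (Dv b).
have -> : 'D_1 (fun t => Psi (t, base x)) 0 = E x by exact: derive_family_base.
rewrite !two_form_local_base => ->.
have dv := is_derive_expRM (omega x a b).
by rewrite derive_val.
Qed.

(* [d theta = omega]: since [d omega = 0], this is Cartan's formula for [L_E omega = omega]. *)
Lemma dtheta x a b :
  'D_a (fun u => one_form_local theta x u b) (base x) -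
  'D_b (fun u => one_form_local theta x u a) (base x) = omega x a b.
Proof.
have dx := chart_at_dom x.
(* As [theta = i_E omega], a derivative of [theta] splits into one of [omega] and one of [E]. After
   antisymmetrization [d omega = 0] converts the former into the derivative along [E]. *)
have DE c d : 'D_c (fun u => one_form_local theta x u d) (base x) =
    'D_c (fun u => two_form_local omega x u (E x) d) (base x) +
    omega x ('D_c (vf_local E x) (base x)) d.
  rewrite -(derive_eq _ (near_theta_local d dx)).
  have D := derive_two_form omega2 c dx (erefl (base x))
    (smooth_near_id (base x)) (euler_smooth dx)
    (smooth_near_cst d (base x)).
  apply: etrans D _; rewrite derive_id derive_cst vf_local_base two_form_local_base.
  by rewrite two_form_local_base (scalar0 (two_formP2 omega2 _ _)) addr0.
have [_ [_ clo _] _ _] := bundleP; have := clo x (E x) a b.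
rewrite /ext_deriv2 => dO; rewrite !DE -(lie_euler_omega x a b).
rewrite (two_form_alt omega2 x a).
move: dO; set dE := 'D_(E x) _ _; set dA := 'D_a _ _; set dB := 'D_b _ _.
move=> dO; have -> : dE = dA - dB.
  by apply/eqP; rewrite -subr_eq0 opprB addrA addrAC dO.
by rewrite opprD !addrA; congr (_ - _); rewrite addrAC.
Qed.

(* [L_X theta = i_X omega + d (theta X)], by [dtheta] *)
Lemma lie_derivative_theta (X : vector_field P) x w :
  differentiable (vf_local X x) (base x) ->
  lie_derivative X theta x w = omega x (X x) w + dfun (contract1 X theta) x w.
Proof.
move=> dX; have dx := chart_at_dom x.
have dth b : differentiable (fun u => one_form_local theta x u b) (base x).
  by apply: smooth_near_diff; exact: theta_local_smooth.
have E1 : \forall u \near base x,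
    one_form_local theta x u (vf_local X x u) = (contract1 X theta \o parat x) u.
  apply: filterS (near_parK dx) => u [du cu].
  by rewrite /one_form_local /contract1 /= /vf_local -{2}cu dcoordK.
have dc : differentiable (fun u => one_form_local theta x u (vf_local X x u)) (base x).
  exact: (differentiable_form (theta_local_scalar x) dth dX).
have E2 : dfun (contract1 X theta) x w =
    'D_w (fun u => one_form_local theta x u (vf_local X x u)) (base x).
  rewrite (deriveE _ dc); have [_ D] := near_eq_diff E1 dc.
  by rewrite /dfun D.
have E3 := derive_form w (theta_local_scalar x) dth dX.
rewrite E2 E3 vf_local_base one_form_local_base -(dtheta x (X x) w).
by rewrite /lie_derivative addrA subrK.
Qed.

(** The pullback of [theta] by [F t], evaluated on [w], is zero for small [t], and its derivative at
    0 is the Lie derivative. A single [w] is considered because a lifted contact flow preserves only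
    the kernel of [theta]. *)
Lemma lie_derivative_family (F : R -> P -> P) x w : smooth_family_at F x x ->
  (\forall t \near (0 : R), theta (F t x) (tangent_map (F t) x w) = 0) ->
  lie_derivative (initial_velocity F) theta x w = 0.
Proof.
move=> sF F0; have dx := chart_at_dom x.
pose Psi := family_in_chart F x.
have sPsi : smooth_near Psi (0, base x) by exact: family_in_chart_smooth0.
pose c t := Psi (t, base x).
pose v t := 'D_((0, w) : R * 'rV[R]_p) Psi (t, base x).
have sv : smooth_near v 0.
  by apply: (@smooth_near_pair1 _ _ _ _ ('D_(0, w) Psi)); exact: smooth_near_derive.
have sc : smooth_near c 0 by exact: smooth_near_pair1.
have c0 : c 0 = base x by exact: family_base.
have v0 : v 0 = w by exact: family_diff0.
have near0 : \forall t \near (0 : R), one_form_local theta x (c t) (v t) = 0.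
  apply: filterS2 F0 (near_family_diff sF w) => t F0t [dt [Et Ea]].
  by rewrite /one_form_local Ea /c /Psi Et coordK.
have dth b : differentiable (fun u => one_form_local theta x u b) (c 0).
  by rewrite c0; apply: smooth_near_diff; exact: theta_local_smooth.
have dB b : differentiable (fun t => one_form_local theta x (c t) b) 0.
  exact: (differentiable_comp (smooth_near_diff sc) (dth b)).
have D := derive_form (1 : R) (fun t => theta_local_scalar x (c t)) dB
  (smooth_near_diff sv).
have := etrans (esym D) (derive_eq (1 : R) near0).
have D3 := derive_comp (1 : R) (smooth_near_diff sc) (dth (v 0)).
have Dc : 'D_1 c 0 = initial_velocity F x by exact: derive_family_base.
have Dv : 'D_1 v 0 = 'D_w (vf_local (initial_velocity F) x) (base x).
  exact: derive_family_diff.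
rewrite derive_cst Dv c0 one_form_local_base => <-.
congr (_ + _); apply/esym; apply: etrans D3 _.
by rewrite Dc v0 c0.
Qed.

Lemma contract1_smooth (X : vector_field P) c x : domat c x ->
  smooth_near (vf_local X c) (coordsat c x) ->
  smooth_near (contract1 X theta \o parat c) (coordsat c x).
Proof.
move=> dx sX.
apply: (@eq_smooth_near _ _ _ (fun u => one_form_local theta c u (vf_local X c u))).
  apply: filterS (near_parK dx) => u [du cu].
  by rewrite /one_form_local /contract1 /= /vf_local -{2}cu dcoordK.
apply: smooth_near_form sX; first exact: theta_local_scalar.
by move=> b; exact: theta_local_smooth.
Qed.

Lemma smooth_vfP (X : vector_field P) :
  smooth_vf X <-> forall c x, domat c x -> smooth_near (vf_local X c) (coordsat c x).
Proof.
split=> sX c.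
  move=> x dx; apply: smooth_on_near (sX c) _; first exact/open_chart_image/openT.
  exact: chart_imageT.
by apply: smooth_near_on => _ [x [dx _] <-]; exact: sX.
Qed.

Lemma smooth_funP (f : P -> R) :
  smooth_fun f <->
  forall c x, domat c x -> smooth_near (f \o parat c) (coordsat c x).
Proof.
split=> sf c.
  by move=> x dx; exact: (smooth_fun_germ openT sf).
by apply: smooth_near_on => _ [x [dx _] <-]; exact: sf.
Qed.

(** * Homogeneous Hamiltonians and presymplectic fields *)

Lemma homogeneous_dfun (f : P -> R) x : smooth_fun f -> homogeneous1 h f ->
  dfun f x (E x) = f x.
Proof.
move=> /smooth_funP sf hf; apply: dfun_euler => [|t].
  by apply: smooth_near_diff; apply: sf; exact: chart_at_dom.
by rewrite hf // gt_eqF // expR_gt0.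
Qed.

Lemma hamiltonian_unique (X : vector_field P) (H : P -> R) :
  homogeneous1 h H -> hamiltonian_vf omega X H -> H = contract1 X theta.
Proof.
move=> hH [_ sH XH]; apply/funext => x.
rewrite -(homogeneous_dfun x sH hH) -[LHS]opprK -XH /contract2.
exact: esym (two_form_alt omega2 x (E x) (X x)).
Qed.

Lemma presymplectic_hamiltonian (X : vector_field P) :
  presymplectic_vf h omega X ->
  homogeneous1 h (contract1 X theta) /\ hamiltonian_vf omega X (contract1 X theta).
Proof.
move=> [sX iX lX]; split.
  by move=> s x s0; rewrite /contract1 -iX // theta_action.
split=> //.
  by apply/smooth_funP => c x dx; apply: contract1_smooth => //;
    move/smooth_vfP: sX; apply.
move=> x w; have dx := chart_at_dom x.
have dX : differentiable (vf_local X x) (base x).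
  by apply: smooth_near_diff; move/smooth_vfP: sX; apply.
have := lie_derivative_theta w dX; rewrite lX => /esym/eqP.
by rewrite addr_eq0 => /eqP.
Qed.

Lemma lift_unique x (v v' : 'rV[R]_p) :
  tangent_map tau x v = tangent_map tau x v' ->
  (forall w, omega x v w = omega x v' w) -> v = v'.
Proof.
move=> tv ov; have [_ _ _ chi0] := bundleP.
apply/eqP; rewrite -subr_eq0; apply/eqP/chi0.
  move=> w; apply: etrans (scalarB v v' (two_formP1 omega2 x w)) _.
  by rewrite ov subrr.
rewrite addrC -scaleN1r tangent_map_linear tv.
by rewrite scaleN1r addNr.
Qed.

End Bundle.

(** * Lifts of contact vector fields *)

Section Cover.
Variable R : realType.

Variables (p m : nat) (P : manifold R p) (M : manifold R m).
Variables (tau : P -> M) (h : R -> P -> P) (omega : two_form P).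
Variables (C : tangent_distribution M) (Xc : vector_field M).
Hypothesis coverP : presymplectic_cover tau h omega C.
Hypothesis contactX : contact_vector_field C Xc.

Notation E := (euler_vf h).
Notation theta := (liouville_form h omega).

Let bundleP : presymplectic_Rx_bundle tau h omega.
Proof. by case: coverP. Qed.

Let omega2 : is_two_form omega.
Proof. by case: bundleP => _ []. Qed.

Lemma fiber_action x x' : tau x = tau x' -> exists2 s : R, s != 0 & x = h s x'.
Proof.
move=> xx'.
have [U [sigma [u [oU Ux _ _ [_ _ _ hs]]]]] := nbhs_trivialization bundleP x.
have [ux0 hx] := hs x Ux.
have [ux'0 hx'] : u x' != 0 /\ h (u x') (sigma (tau x')) = x'.
  by apply: hs; rewrite -xx'.
exists (u x / u x'); first by rewrite mulf_neq0 // invr_eq0.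
rewrite -{2}hx' (actionM bundleP) ?mulf_neq0 ?invr_eq0 //.
by rewrite divfK // -xx' hx.
Qed.

Lemma theta_vertical x v : tangent_map tau x v = 0 -> theta x v = 0.
Proof.
move=> /(vertical_euler bundleP)[c ->].
by rewrite (scalarZ _ _ (theta_scalar bundleP x)) (theta_euler bundleP) mulr0.
Qed.

(** So [theta x] factors through the tangent map of [tau], and can be evaluated on vectors of the
    base. *)
Lemma theta_lift x v v' : tangent_map tau x v = tangent_map tau x v' ->
  theta x v = theta x v'.
Proof.
move=> vv'; apply/eqP; rewrite -subr_eq0 -(scalarB _ _ (theta_scalar bundleP x)).
apply/eqP/theta_vertical.
by rewrite addrC -scaleN1r tangent_map_linear vv' scaleN1r addNr.
Qed.

(** The cover condition only provides a vector of the kernel at some point of the fibre. The action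
    moves it to [x], since it preserves the kernel of [theta], and two lifts of one vector have the
    same value under [theta]. *)
Lemma theta_eq0 x v : theta x v = 0 <-> C (tau x) (tangent_map tau x v).
Proof.
have [_ CE] := coverP; rewrite CE; split=> [th0|[x' [v' [xx' th' tv']]]].
  by exists x, v.
have [s s0 xE] := fiber_action (esym xx').
subst x; rewrite (theta_lift (v' := tangent_map (h s) x' v')).
  by rewrite (theta_action bundleP) // th' mulr0.
by rewrite (tau_tangent_action bundleP).
Qed.

(* The lift [Phi] of the flow of [Xc] given by a local trivialization need not preserve
   [theta], but it maps [ker theta] to [ker theta]. *)
Lemma local_lift (x0 : P) : exists (Phi : R -> P -> P) (O : set P),
  [/\ open O, O x0,
      forall c x, O x -> domat c x -> smooth_family_at Phi c x,
      forall x w, O x -> theta x w = 0 ->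
        \forall t \near (0 : R), theta (Phi t x) (tangent_map (Phi t) x w) = 0 &
      forall x, O x -> tangent_map tau x (initial_velocity Phi x) = Xc (tau x)].
Proof.
have [_ /(_ (tau x0))[e [U' [phi [e0 oU' U'x0 [sphi phi0 vphi] phiC]]]]] := contactX.
have [U [sigma [u [oU Ux0 ss su [otU ts us hs]]]]] := nbhs_trivialization bundleP x0.
(* The base point follows [phi] while the fibre coordinate [u] is held constant. *)
pose Phi t x := h (u x) (sigma (phi t (tau x))).
have tau_cont (x : P) : {for x, continuous tau}.
  apply: smooth_germ_map_continuous; apply: (tau_germ bundleP).
  exact: chart_at_dom.
have oW : open [set q : R * M | `|q.1| < e /\ U' q.2].
  rewrite openE => -[t y] /= [te U'y].
  have nt : nbhs (t, y) (fst @^-1` [set t : R | `|t| < e]).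
    apply: (@cvg_fst _ _ (nbhs t) (nbhs y)).
    have oe : open [set t : R | `|t| < e].
      apply: (@open_comp _ _ (fun s : R => `|s|) [set s : R | s < e]).
        by move=> s _; exact: norm_continuous.
      exact: open_lt.
    by apply: open_nbhs_nbhs; split.
  have ny : nbhs (t, y) (snd @^-1` U').
    by apply: (@cvg_snd _ _ (nbhs t) (nbhs y)); apply: open_nbhs_nbhs; split.
  by apply: filterS2 nt ny.
have phig t y : `|t| < e -> U' y ->
    smooth_germ (fun q => phi q.1 (parat y q.2)) (t, base y).
  move=> te U'y; apply: (smooth_family_germ oW sphi) => //; exact: chart_at_dom.
have e00 : `|0 : R| < e by rewrite normr0.
pose O := tau @^-1` (U `&` U').
have oO : open O.
  by apply: open_comp; [move=> x _; exact: tau_cont|exact: openI].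
have g2 c x : O x -> domat c x ->
    smooth_germ (fun q : R * 'rV[R]_p => phi q.1 (tau (parat c q.2))) (0, coordsat c x).
  move=> [Ux U'x] dx.
  apply: (@smooth_germ_family _ _ _ _ _ _ fst (fun q => tau (parat c q.2)) phi (tau x)).
  - by apply: smooth_near_linear; exact: is_diff_fst.
  - apply: (@smooth_germ_comp _ _ _ _ _ snd (tau \o parat c)).
      by apply: smooth_near_linear; exact: is_diff_snd.
    exact: (tau_germ bundleP).
  - by rewrite /= coordK //; exact: chart_at_dom.
  - by rewrite /= coordK //; exact: phig.
have sPhi c x : O x -> domat c x -> smooth_family_at Phi c x.
  move=> Ox dx; have [Ux U'x] := Ox; split; last first.
    have nO : \forall z \near x, O z by exact: (open_nbhs_nbhs (conj oO Ox)).
    apply: filterS nO => z [Uz U'z].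
    by rewrite /Phi phi0 //; exact: (hs z Uz).2.
  have [ux0 _] := hs x Ux.
  have g2x := g2 c x Ox dx.
  have p0 : phi 0 (tau (parat c (coordsat c x))) = tau x by rewrite coordK // phi0.
  apply: (@smooth_germ_family _ _ _ _ _ _ (fun q => u (parat c q.2))
    (fun q => sigma (phi q.1 (tau (parat c q.2)))) h (sigma (tau x))).
  - apply: (@smooth_near_lin _ _ _ _ snd (u \o parat c)); first exact: is_diff_snd.
    exact: (smooth_fun_germ otU su).
  - apply: (smooth_germ_map (c := tau x) g2x); rewrite /= p0.
      exact: chart_at_dom.
    by apply: (smooth_map_germ oU ss) => //; exact: chart_at_dom.
  - by rewrite /= p0; exact: chart_at_dom.
  - rewrite /= p0 coordK //; apply: (action_germ bundleP) => //; exact: chart_at_dom.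
(* The section property of [sigma] holds on [U] only, so [phi] must not leave [U]. Closeness is
   asked jointly in time and space, so that the tangent maps can be compared at each small [t]. *)
have tauPhi x : O x -> \forall q \near ((0 : R), base x),
    tau (Phi q.1 (parat x q.2)) = phi q.1 (tau (parat x q.2)).
  move=> Ox; have [Ux U'x] := Ox; have dx := chart_at_dom x.
  have p0 : phi 0 (tau (parat x (base x))) = tau x by rewrite parat_base phi0.
  have nU : \forall q \near ((0 : R), base x), U (phi q.1 (tau (parat x q.2))).
    apply: (smooth_germ_near (Q := U) (g2 x x Ox dx)); rewrite /= p0.
    exact: open_nbhs_nbhs.
  have nO : \forall w \near base x, O (parat x w).
    by apply: near_par => //; exact: open_nbhs_nbhs.
  have nO2 : \forall q \near ((0 : R), base x), O (parat x q.2).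
    exact: (@cvg_snd _ _ (nbhs (0 : R)) (nbhs (base x)) _ _ nO).
  apply: filterS2 nU nO2 => q Uq [Uz _].
  rewrite /Phi (tau_action bundleP) ?ts //.
  exact: (hs _ Uz).1.
exists Phi, O; split=> //.
- move=> x w Ox th0; have [Ux U'x] := Ox; have dx := chart_at_dom x.
  have [sPx _] := sPhi x x Ox dx.
  have te : \forall t \near (0 : R), `|t| < e by exact: nbhs0_lt.
  apply: filterS3 te (near_pair1 (near_join (tauPhi x Ox)))
    (near_pair1 (smooth_germ_nearby sPx)) => t te tauP sP.
  have tP := near_pair2 tauP.
  have sPt : smooth_germ (Phi t \o parat x) (base x) := family_map_germ sP.
  have PE : (Phi t \o parat x) (base x) = Phi t x by rewrite /= parat_base.
  apply/theta_eq0.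
  have -> : tau (Phi t x) = phi t (tau x).
    by have := nbhs_singleton tP; rewrite /= parat_base.
  have spt : smooth_germ (phi t \o parat (tau x)) (base (tau x)).
    exact: (family_map_germ (phig t (tau x) te U'x)).
  have stx : smooth_germ (tau \o parat x) (base x) := tau_germ bundleP dx.
  have tE : (tau \o parat x) (base x) = tau x by rewrite /= parat_base.
  have -> : tangent_map tau (Phi t x) (tangent_map (Phi t) x w) =
      tangent_map (phi t) (tau x) (tangent_map tau x w).
    rewrite (tangent_mapE (Phi t) x) (tangent_mapE tau x).
    have stP : smooth_germ (tau \o parat (Phi t x)) (base (Phi t x)).
      by apply: (tau_germ bundleP); exact: chart_at_dom.
    have sTP : smooth_germ (tau \o (Phi t \o parat x)) (base x).
      by apply: (smooth_germ_map (c := Phi t x) sPt); rewrite PE; first exact: chart_at_dom.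
    have tP' : \forall w \near base x,
      (tau \o (Phi t \o parat x)) w = (phi t \o (tau \o parat x)) w by [].
    apply: etrans (esym (dmap_map_at w PE sPt stP)) _.
    apply: etrans (congr1 (fun f => f w) (eq_dmap sTP tP')) _.
    exact: (dmap_map_at w tE stx spt).
  rewrite -phiC //; exists (tangent_map tau x w) => //.
  exact/theta_eq0.
- move=> x Ox; have [Ux U'x] := Ox; have dx := chart_at_dom x.
  have [sPx /nbhs_singleton Phi0] := sPhi x x Ox dx.
  have sc := family_curve_germ dx sPx.
  rewrite /initial_velocity velocityE // -(dmap_map_at _ Phi0) //; last first.
    exact: (tau_germ bundleP).
  have sp : smooth_germ (phi ^~ (tau x)) 0.
    exact: (family_curve_germ (chart_at_dom (tau x)) (phig 0 (tau x) e00 U'x)).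
  have near_eq : \forall t \near (0 : R), phi t (tau x) = (tau \o Phi ^~ x) t.
    apply: filterS (near_pair1 (tauPhi x Ox)) => t.
    by rewrite /= parat_base.
  by rewrite -(eq_dmap sp near_eq) -velocityE // vphi // phi0.
Qed.

End Cover.

(** * The Hamiltonian lift of a contact field *)

Section Existence.
Variable R : realType.

Variables (p m : nat) (P : manifold R p) (M : manifold R m).
Variables (tau : P -> M) (h : R -> P -> P) (omega : two_form P).
Variables (C : tangent_distribution M) (Xc : vector_field M).
Hypothesis coverP : presymplectic_cover tau h omega C.
Hypothesis contactX : contact_vector_field C Xc.

Notation E := (euler_vf h).
Notation theta := (liouville_form h omega).

Let bundleP : presymplectic_Rx_bundle tau h omega.
Proof. by case: coverP. Qed.

Let omega2 : is_two_form omega.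
Proof. by case: bundleP => _ []. Qed.

Lemma lift_exists x : exists v, tangent_map tau x v = Xc (tau x).
Proof.
have [Phi [N [_ Nx _ _ tauY]]] := local_lift coverP contactX x.
by exists (initial_velocity Phi x); exact: tauY.
Qed.

(** All lifts give the same value, so the arbitrary choice at each point leaves no trace; near a
    given point a smooth lift may be substituted. *)
Definition lift_hamiltonian (x : P) : R := theta x (sval (cid (lift_exists x))).

Notation H := lift_hamiltonian.

Lemma lift_hamiltonianE x v : tangent_map tau x v = Xc (tau x) -> H x = theta x v.
Proof.
move=> tv; apply: (theta_lift coverP); rewrite tv.
exact: (svalP (cid (lift_exists x))).
Qed.

Lemma lift_hamiltonian_homogeneous : homogeneous1 h H.
Proof.
move=> s x s0; have [v tv] := lift_exists x.
rewrite (lift_hamiltonianE (v := tangent_map (h s) x v)).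
  by rewrite (theta_action bundleP) // (lift_hamiltonianE tv).
by rewrite (tau_tangent_action bundleP) // (tau_action bundleP).
Qed.

(* Near [x0], [H = theta Y] and [L_Y theta] vanishes on [ker theta]; hence [i_Y omega + dH]
   is a multiple of [theta]. *)
Lemma local_hamiltonian_lift (x0 : P) : exists (Y : vector_field P) (N : set P),
  [/\ open N, N x0,
      forall c x, N x -> domat c x -> smooth_near (vf_local Y c) (coordsat c x),
      forall c x, N x -> domat c x -> smooth_near (H \o parat c) (coordsat c x) &
      forall x, N x -> tangent_map tau x (Y x) = Xc (tau x) /\
        forall w, theta x w = 0 -> omega x (Y x) w + dfun H x w = 0].
Proof.
have [Phi [N [oN Nx0 sPhi thPhi tauY]]] := local_lift coverP contactX x0.
pose Y := initial_velocity Phi.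
have sY c x : N x -> domat c x -> smooth_near (vf_local Y c) (coordsat c x).
  by move=> Nx dx; apply: (initial_velocity_smooth _ dx); exact: sPhi.
have HY c x : N x -> domat c x -> \forall u \near coordsat c x,
    (contract1 Y theta \o parat c) u = (H \o parat c) u.
  move=> Nx dx; have nN : \forall z \near x, N z by exact: (open_nbhs_nbhs (conj oN Nx)).
  apply: filterS (near_par dx nN) => u Nu.
  exact/esym/lift_hamiltonianE/tauY.
have sthY c x : N x -> domat c x ->
    smooth_near (contract1 Y theta \o parat c) (coordsat c x).
  by move=> Nx dx; apply: (contract1_smooth bundleP) => //; exact: sY.
exists Y, N; split=> //.
  by move=> c x Nx dx; exact: eq_smooth_near (HY c x Nx dx) (sthY c x Nx dx).
move=> x Nx; split=> [|w th0]; first exact: tauY.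
have dx := chart_at_dom x.
have := lie_derivative_theta bundleP w (smooth_near_diff (sY x x Nx dx)).
rewrite (lie_derivative_family bundleP (sPhi x x Nx dx) (thPhi x w Nx th0)).
move=> /esym; have [_ D] := near_eq_diff (HY x x Nx dx) (smooth_near_diff (sthY x x Nx dx)).
by rewrite /dfun D.
Qed.

Lemma lift_hamiltonian_smooth : smooth_fun H.
Proof.
apply/smooth_funP => c x dx.
by have [Y [N [_ Nx _ sH _]]] := local_hamiltonian_lift x; exact: sH.
Qed.

(** A condition on one tangent vector: once [H] is known to be smooth, finding the field is linear
    algebra in each tangent space. *)
Definition is_hamiltonian_lift x v : Prop :=
  tangent_map tau x v = Xc (tau x) /\ forall w, omega x v w = - dfun H x w.

Lemma is_hamiltonian_lift_unique x v v' :
  is_hamiltonian_lift x v -> is_hamiltonian_lift x v' -> v = v'.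
Proof.
move=> [tv ov] [tv' ov'].
apply: (lift_unique bundleP (etrans tv (esym tv'))) => w.
by rewrite ov ov'.
Qed.

(** A covector that vanishes on the kernel of [theta x] is a multiple of [theta x]; the factor is
    read off at [w0], and subtracting that multiple of [E x] removes it because
    [i_E omega = theta]. *)
Lemma hamiltonian_lift_formula x y w0 : tangent_map tau x y = Xc (tau x) ->
  (forall w, theta x w = 0 -> omega x y w + dfun H x w = 0) ->
  theta x w0 != 0 ->
  is_hamiltonian_lift x (y - ((omega x y w0 + dfun H x w0) / theta x w0) *: E x).
Proof.
move=> ty ker0 th0.
set g := _ / _; split.
  rewrite addrC -scaleNr tangent_map_linear (tau_euler bundleP) scaler0 add0r.
  exact: ty.
move=> w.
have dH : scalar (dfun H x) by move=> a u v; exact: dfun_linear.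
have oy := two_formP2 omega2 x y.
have ths := theta_scalar bundleP x.
(* The projection of [w] to the kernel of [theta x] along [w0]. *)
have := ker0 (w - (theta x w / theta x w0) *: w0).
rewrite (scalarB _ _ ths) (scalarZ _ _ ths) divfK // subrr => /(_ erefl).
rewrite (scalarB _ _ dH) (scalarZ _ _ dH) (scalarB _ _ oy) (scalarZ _ _ oy) => K.
apply: etrans (scalarB _ _ (two_formP1 omega2 x w)) _.
rewrite (scalarZ g (E x) (two_formP1 omega2 x w)).
rewrite -[omega x (E x) w]/(theta x w) /g.
apply/eqP; rewrite -subr_eq0 opprK -[X in _ == X]K; apply/eqP.
by field.
Qed.

Lemma hamiltonian_lift_exists x : exists v, is_hamiltonian_lift x v.
Proof.
have [Y [N [_ Nx _ _ HY]]] := local_hamiltonian_lift x.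
have [w0 th0] := theta_neq0 bundleP x; have [tY kY] := HY x Nx.
by eexists; exact: (hamiltonian_lift_formula tY kY th0).
Qed.

Definition hamiltonian_lift : vector_field P :=
  fun x => sval (cid (hamiltonian_lift_exists x)).

Notation X := hamiltonian_lift.

Lemma hamiltonian_liftP x : is_hamiltonian_lift x (X x).
Proof. exact: (svalP (cid (hamiltonian_lift_exists x))). Qed.

Lemma hamiltonian_lift_smooth : smooth_vf X.
Proof.
apply/smooth_vfP => c x dx.
have [Y [N [oN Nx sY sH HY]]] := local_hamiltonian_lift x.
have [w0 th0] := theta_neq0 bundleP x.
(* [w0] is extended with constant components in the chart at [c]; by continuity [theta] stays
   nonzero on this extension near [x]. *)
pose a := dcoord c x w0.
pose th u := one_form_local theta c u a.
pose lam u := two_form_local omega c u (vf_local Y c u) a + 'D_a (H \o parat c) u.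
have sth : smooth_near th (coordsat c x) by exact: (theta_local_smooth bundleP).
have thx : th (coordsat c x) != 0.
  by rewrite /th /one_form_local coordK // dcoordK.
apply: (@eq_smooth_near _ _ _
    (fun u => vf_local Y c u + (- 1) * (lam u * (th u)^-1) *: vf_local E c u)).
  have nth : \forall u \near coordsat c x, th u != 0.
    have /smooth_near_continuous := sth.
    by move/(_ [set z | z != 0]); apply; apply: open_nbhs_nbhs; split => //;
      exact: open_neq.
  have nN : \forall z \near x, N z by exact: (open_nbhs_nbhs (conj oN Nx)).
  (* At each nearby [z] the formula, with the constant extension as auxiliary vector, gives a
     Hamiltonian lift; uniqueness identifies it with the value chosen for [X z]. *)
  have key z : N z -> domat c z -> th (coordsat c z) != 0 ->
      vf_local Y c (coordsat c z) + (- 1) *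
        (lam (coordsat c z) * (th (coordsat c z))^-1) *: vf_local E c (coordsat c z)
      = vf_local X c (coordsat c z).
    move=> Nz dz thz; have [tY kY] := HY z Nz.
    have thE : th (coordsat c z) = theta z (dpar c (coordsat c z) a).
      by rewrite /th /one_form_local coordK.
    rewrite thE in thz.
    have XE := is_hamiltonian_lift_unique (hamiltonian_liftP z)
      (hamiltonian_lift_formula tY kY thz).
    have vfE (Z : vector_field P) : vf_local Z c (coordsat c z) = dcoord c z (Z z).
      by rewrite /vf_local coordK.
    have sp : smooth_germ (parat c) (coordsat c z) by exact: smooth_germ_par.
    have dH : differentiable (H \o parat (parat c (coordsat c z)))
        (base (parat c (coordsat c z))).
      rewrite coordK //; apply: smooth_near_diff; apply: sH => //.
      exact: chart_at_dom.
    have dHE := (diff_fun a sp dH).2; rewrite coordK // in dHE.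
    have lamE : lam (coordsat c z) = omega z (Y z) (dpar c (coordsat c z) a) +
        dfun H z (dpar c (coordsat c z) a).
      rewrite -dHE -(deriveE _ (smooth_near_diff (sH c z Nz dz))).
      by rewrite /lam /two_form_local coordK // vfE dcoordK.
    rewrite !vfE lamE thE XE mulN1r scaleNr.
    set b := Y z; set g := _ / _.
    have -> : b - g *: E z = (- g) *: E z + b by rewrite scaleNr addrC.
    by rewrite dcoord_linear scaleNr addrC.
  apply: filterS3 nth (near_par dx nN) (near_parK dx) => u thu Nu [du cu].
  by have := key _ Nu du; rewrite cu; apply.
apply: smooth_nearD; first exact: sY.
apply: smooth_nearZ; last exact: (euler_smooth bundleP).
apply: smooth_nearM; first exact: smooth_near_cst.
apply: smooth_nearM; last exact: smooth_nearV.
apply: smooth_nearD; last by apply: smooth_near_derive; exact: sH.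
apply: (two_form_local_smooth_along omega2 dx) => //.
- exact: smooth_near_id.
- exact: sY.
- exact: smooth_near_cst.
Qed.

Lemma dfun_action (f : P -> R) (s : R) x v : smooth_fun f -> homogeneous1 h f ->
  s != 0 -> dfun f (h s x) (tangent_map (h s) x v) = s * dfun f x v.
Proof.
move=> /smooth_funP sf hf s0; have dx := chart_at_dom x.
have sh : smooth_germ (h s \o parat x) (base x) by exact: (action_fixed_germ bundleP).
have hE : (h s \o parat x) (base x) = h s x by rewrite /= parat_base.
have dfh : differentiable (f \o parat ((h s \o parat x) (base x)))
    (base ((h s \o parat x) (base x))).
  by apply: smooth_near_diff; apply: sf; exact: chart_at_dom.
have [_ D] := diff_fun v sh dfh.
rewrite hE in D; rewrite tangent_mapE -D.
have dfx : differentiable (f \o parat x) (base x).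
  by apply: smooth_near_diff; exact: sf.
have -> : f \o (h s \o parat x) = s *: (f \o parat x).
  by apply/funext => u /=; rewrite hf.
by rewrite (diffZ s dfx).
Qed.

(** Transport by [h s] multiplies both [omega] and [dH] by [s] and preserves projections, so it
    sends the Hamiltonian lift at [x] to one at [h s x]. *)
Lemma hamiltonian_lift_invariant : invariant_vf h X.
Proof.
move=> s x s0; have [tX oX] := hamiltonian_liftP x.
apply: is_hamiltonian_lift_unique (hamiltonian_liftP (h s x)); split.
  by rewrite (tau_tangent_action bundleP) // tX (tau_action bundleP).
move=> w; rewrite -(tangent_actionVK bundleP x w s0).
set v := tangent_map (h s^-1) _ w.
rewrite (omega_action bundleP) // oX dfun_action ?mulrN //.
  exact: lift_hamiltonian_smooth.
exact: lift_hamiltonian_homogeneous.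
Qed.

Lemma contact_hamiltonian_lift :
  exists! HX : (P -> R) * vector_field P,
    homogeneous1 h HX.1 /\ invariant_vf h HX.2 /\
    hamiltonian_vf omega HX.2 HX.1 /\ projects_to tau HX.2 Xc.
Proof.
exists (H, X); split=> [|[H' X'] /= [hH' [iX' [HX' tX']]]].
  split; first exact: lift_hamiltonian_homogeneous.
  split; first exact: hamiltonian_lift_invariant.
  split; last by move=> x; case: (hamiltonian_liftP x).
  split; [exact: hamiltonian_lift_smooth|exact: lift_hamiltonian_smooth|].
  by move=> x v; case: (hamiltonian_liftP x) => _; apply.
(* Homogeneity forces [H'] to be [theta] of [X'], and [X'] is a lift of [Xc]. *)
have HH' : H = H'.
  rewrite (hamiltonian_unique bundleP hH' HX'); apply/funext => x.
  exact: lift_hamiltonianE.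
congr pair; first exact: HH'.
apply/funext => x; apply: is_hamiltonian_lift_unique (hamiltonian_liftP x) _.
split; first exact: tX'.
by move=> w; rewrite HH'; case: HX' => _ _; apply.
Qed.

End Existence.

Theorem proposition4p2 (R : realType) (p m : nat)
    (P : manifold R p) (M : manifold R m) (tau : P -> M) (h : R -> P -> P)
    (omega : two_form P) (C : tangent_distribution M)
    (precontactC : precontact C)
    (coverP : presymplectic_cover tau h omega C) :
  (forall X : vector_field P, presymplectic_vf h omega X ->
     unique (fun H : P -> R => homogeneous1 h H /\ hamiltonian_vf omega X H)
            (contract1 X (liouville_form h omega))) /\
  (forall Xc : vector_field M, contact_vector_field C Xc ->
     exists! HX : (P -> R) * vector_field P,
       homogeneous1 h HX.1 /\ invariant_vf h HX.2 /\
       hamiltonian_vf omega HX.2 HX.1 /\ projects_to tau HX.2 Xc).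
Proof.
have [bundleP _] := coverP.
split=> [X symX|Xc contactX]; last exact: (contact_hamiltonian_lift coverP contactX).
split; first exact: (presymplectic_hamiltonian bundleP symX).
by move=> H [hH HX]; rewrite (hamiltonian_unique bundleP hH HX).
Qed.
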